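(* Let $A\in\mathbb{R}^{n\times n}$ be invertible, $B\in\mathbb{R}^{n\times n}$ symmetric positive definite, and let $S\in\mathbb{R}^{n\times q}$ be a random matrix (with $q$ possibly random) which has full column rank with probability $1$. Then the iterates of Algorithm 1 (row variant) satisfy, for all $k\ge 0$, $$\mathbf{E}[X_{k+1}-A^{-1}]=(I-B^{-1}\mathbf{E}[Z])\,\mathbf{E}[X_k-A^{-1}].$$ Let $X_0\in\mathbb{R}^{n\times n}$. If $X_k$ is obtained either (1) by applying $k$ iterations of Algorithm 1 from $X_0$, or (2) by applying $k$ iterations of Algorithm 3 (symmetric variant) from $X_0$, assuming in this case that $A$ and $X_0$ are symmetric, then $$\|\mathbf{E}[X_k-A^{-1}]\|_B^*\le\rho^k\,\|X_0-A^{-1}\|_B^*,\qquad \rho=1-\lambda_{\min}(B^{-1/2}\mathbf{E}[Z]B^{-1/2}).$$ Moreover, $$0\le1-\frac{\mathbf{E}[q]}{n}\le\rho\le1 .$$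
   Context: $Z=A^\top S(S^\top AB^{-1}A^\top S)^{-1}S^\top A$. $\|Y\|_B^*=\|B^{1/2}YB^{1/2}\|_2$, where $\|\cdot\|_2$ is the spectral norm; $\lambda_{\min}$ is the smallest eigenvalue; $B^{-1/2}$ is the symmetric positive definite square root of $B^{-1}$. Algorithm 1 (row variant): given deterministic $X_0\in\mathbb{R}^{n\times n}$, in each iteration draw a fresh independent copy of $S$ and set $X_{k+1}=X_k+B^{-1}A^\top S(S^\top AB^{-1}A^\top S)^{-1}S^\top(I-AX_k)$. Algorithm 3 (symmetric variant, $A$ and $X_0$ symmetric): in each iteration draw a fresh independent copy of $S$, set $\Lambda=S(S^\top AB^{-1}AS)^{-1}S^\top$, $\Theta=\Lambda AB^{-1}$, $M_k=X_kA-I$, and $X_{k+1}=X_k-M_k\Theta-(M_k\Theta)^\top+\Theta^\top(AX_kA-A)\Theta$. *)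

(* Defs.v *)
From HB Require Import structures.
From mathcomp Require Import all_boot all_order all_algebra.
From mathcomp Require Import all_classical all_reals all_analysis.

Set Implicit Arguments.
Unset Strict Implicit.
Unset Printing Implicit Defensive.

Import Order.TTheory GRing.Theory Num.Theory.
Import numFieldNormedType.Exports.

Local Open Scope classical_set_scope.
Local Open Scope ring_scope.

Definition posdefmx (R : realType) (n : nat) (B : 'M[R]_n) : Prop :=
  B^T = B /\ forall v : 'cV[R]_n, v != 0 -> 0 < (v^T *m B *m v) 0 0.

(* The default value 0 is returned only if there is no such square root. *)
Definition posdef_sqrt (R : realType) (n : nat) (B : 'M[R]_n) : 'M[R]_n :=
  xget 0 [set C | posdefmx C /\ C *m C = B].

Definition l2norm (R : realType) (n : nat) (v : 'cV[R]_n) : R :=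
  Num.sqrt (\sum_i v i 0 ^+ 2).

(* For n = 0 there is no unit vector and this is [sup set0]. *)
Definition spectral_norm (R : realType) (n : nat) (M : 'M[R]_n) : R :=
  sup [set l2norm (M *m v) | v in [set v : 'cV[R]_n | l2norm v = 1]].

Definition dual_Bnorm (R : realType) (n : nat) (B Y : 'M[R]_n) : R :=
  spectral_norm (posdef_sqrt B *m Y *m posdef_sqrt B).

(* The spectrum is finite, so [inf] is a minimum as soon as [M] has a real
   eigenvalue, e.g. when [M] is symmetric and 0 < n. *)
Definition lambda_min (R : realType) (n : nat) (M : 'M[R]_n) : R :=
  inf [set a : R | eigenvalue M a].

(* The values of a random matrix with [n] rows whose number of columns is
   itself random. *)
Definition tallmx (R : realType) (n : nat) : Type :=
  {q : nat & 'M[R]_(n, q)}.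

HB.instance Definition _ (R : realType) (n : nat) :=
  Choice.on (tallmx R n).
HB.instance Definition _ (R : realType) (n : nat) :=
  isPointed.Build (tallmx R n)
    (Tagged (fun q => 'M[R]_(n, q)) (0 : 'M[R]_(n, 0))).

Definition tallmx_open (R : realType) (n : nat) : set (set (tallmx R n)) :=
  [set V | exists (q : nat) (U : set 'M[R]_(n, q)),
     open U /\ V = [set Tagged (fun q => 'M[R]_(n, q)) M | M in U]].

(* The sigma-algebra is the disjoint union, over q : nat, of the Borel
   sigma-algebras of the spaces 'M[R]_(n, q): the number of columns is
   measurable and, where it equals q, so are the entries. *)
Definition sketch (R : realType) (n : nat) :=
  g_sigma_algebraType (@tallmx_open R n).

Definition ncols (R : realType) (n : nat) (s : sketch R n) : nat := tag s.

Definition sketchmx (R : realType) (n : nat) (s : sketch R n) :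
  'M[R]_(n, ncols s) := tagged s.

(* [invmx M] is [M] itself when [M] is singular; below, this can happen only
   where [s] does not have full column rank. *)
Definition Zmx (R : realType) (n : nat) (A B : 'M[R]_n) (s : sketch R n) :
  'M[R]_n :=
  let S := sketchmx s in
  A^T *m S *m invmx (S^T *m A *m invmx B *m A^T *m S) *m S^T *m A.

Definition alg1_step (R : realType) (n : nat) (A B : 'M[R]_n)
    (s : sketch R n) (X : 'M[R]_n) : 'M[R]_n :=
  let S := sketchmx s in
  X + invmx B *m A^T *m S *m invmx (S^T *m A *m invmx B *m A^T *m S)
      *m S^T *m (1%:M - A *m X).

Definition alg3_step (R : realType) (n : nat) (A B : 'M[R]_n)
    (s : sketch R n) (X : 'M[R]_n) : 'M[R]_n :=
  let S := sketchmx s in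
  let Lambda := S *m invmx (S^T *m A *m invmx B *m A *m S) *m S^T in
  let Theta := Lambda *m A *m invmx B in
  let M := X *m A - 1%:M in
  X - M *m Theta - (M *m Theta)^T
    + Theta^T *m (A *m X *m A - A) *m Theta.

Section random.
Context (d : measure_display) (T : measurableType d) (R : realType)
        (P : probability T R).

Fixpoint iterates (n : nat) (step : sketch R n -> 'M[R]_n -> 'M[R]_n)
    (draw : nat -> T -> sketch R n) (X0 : 'M[R]_n) (k : nat) (w : T) :
    'M[R]_n :=
  if k is k'.+1 then step (draw k' w) (iterates step draw X0 k' w) else X0.

Definition mutually_independent (d' : measure_display)
    (T' : measurableType d') (X : nat -> {RV P >-> T'}) : Prop :=
  forall (J : seq nat) (U : nat -> set T'),
    uniq J -> (forall j, measurable (U j)) ->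
    (P (\bigcap_(j in [set` J]) (X j @^-1` U j))
      = \prod_(j <- J) P (X j @^-1` U j))%E.

Definition iid_copies (d' : measure_display) (T' : measurableType d')
    (Y : {RV P >-> T'}) (X : nat -> {RV P >-> T'}) : Prop :=
  mutually_independent X /\
  forall (k : nat) (U : set T'), measurable U ->
    distribution P (X k) U = distribution P Y U.

Definition integrable_mx (m n : nat) (X : T -> 'M[R]_(m, n)) : Prop :=
  forall i j, P.-integrable setT (fun w => (X w i j)%:E).

(* Entrywise expectation; the value is meaningful under [integrable_mx X]. *)
Definition expectation_mx (m n : nat) (X : T -> 'M[R]_(m, n)) : 'M[R]_(m, n) :=
  \matrix_(i, j) fine ('E_P[fun w => X w i j])%E.

End random.

(* Main.v *)
(** Write [Y = X - A^-1].  One step of the row variant maps [Y] to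
    [(I - B^-1 Z) Y], one step of the symmetric variant maps a symmetric [Y] to
    [(I - B^-1 Z) Y (I - Z B^-1)].  The current iterate is independent of the
    fresh draw, so taking expectations replaces [Y] by [E Y] inside these
    formulas, which gives the first identity.  After conjugation by [B^(1/2)]
    the step involves [I - Pi], where [Pi = B^(-1/2) Z B^(-1/2)] is almost surely
    an orthogonal projection of rank [q].  Hence [0 <= E Pi <= I],
    [|(I - E Pi) v| <= rho |v|], and for the symmetric variant, with [L] the norm
    of [W],
      [2 u.E((I - Pi) W (I - Pi)) v
         <= L E(|(I - Pi) u|^2 + |(I - Pi) v|^2)
         <= L rho (|u|^2 + |v|^2)],
    which bounds the norm by [rho L].  Finally
    [n lambda_min(E Pi) <= tr (E Pi) = E q].

    All expectations are taken over a version of [Z] which vanishes where the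
    Gram matrix is singular: it agrees almost surely with [Z] and is bounded
    everywhere. *)

Require Import Defs.
From mathcomp Require Import all_boot all_order all_algebra.
From mathcomp Require Import complex.
From mathcomp Require Import all_classical all_reals all_analysis.
From mathcomp Require Import measurable_realfun.
From mathcomp Require Import ring lra.
Import Order.TTheory GRing.Theory Num.Theory.
Import numFieldNormedType.Exports.
Set Implicit Arguments.
Unset Strict Implicit.
Unset Printing Implicit Defensive.
Local Open Scope classical_set_scope.
Local Open Scope ring_scope.

(** * Real symmetric matrices and the spectral norm *)

Section SpectralTheorem.
Variable R : rcfType.
Local Notation toC := (real_complex R).

(** Over the complex numbers [B] is Hermitian, so it is unitarily diagonalizable with real spectrum
    [s], and [p(B)] is conjugate to the diagonal matrix of the values of [p] on [s]. This packages
    real diagonalizability without an eigenbasis: functions of [B] are then built as polynomials in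
    [B]. *)
Lemma symmx_split n (B : 'M[R]_n.+1) : B^T = B ->
  exists2 s : seq R, {in s, forall a, eigenvalue B a} &
    forall p : {poly R}, {in s, forall a, p.[a] = 0} -> horner_mx B p = 0.
Proof.
move=> symB; pose C := map_mx toC B.
have hC : C \is hermsymmx.
  apply/is_hermitianmxP; rewrite expr0 scale1r.
  apply/matrixP => i j; rewrite !mxE -[in LHS]symB mxE.
  by apply/esym/CrealP/complex_realP; exists (B j i).
have /orthomx_spectralP := hermitian_normalmx hC.
set U := spectralmx C; set d := spectral_diag C => defC.
have Uunit : U \in unitmx := spectral_unit C.
have rd i : exists a, d 0 i = toC a.
  apply/complex_realP.
  by have /mxOverP := hermitian_spectral_diag_real hC; apply.
have [f fE] : exists f : 'I_n.+1 -> R, forall i, d 0 i = toC (f i).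
  by have [f fE] := choice rd; exists f.
exists [seq f i | i <- enum 'I_n.+1] => [_ /mapP[i _ ->]|p p0].
  rewrite eigenvalue_root_char -(fmorph_root toC) map_char_poly.
  rewrite -eigenvalue_root_char -[X in eigenvalue _ X]/(toC (f i)) -fE.
  apply/eigenvalueP; exists (row i U).
    rewrite -/C defC -row_mul !mulmxA mulmxV// mul1mx row_mul.
    suff -> : row i (diag_mx d) = d 0 i *: delta_mx 0 i.
      by rewrite -scalemxAl -rowE.
    by apply/rowP => j; rewrite !mxE eqxx /= mulr_natr eq_sym.
  apply/eqP => /rowP rU0; have := row_free_unit U; rewrite Uunit.
  move=> /row_freeP[V UV]; have /matrixP/(_ i i) := UV.
  rewrite !mxE eqxx big1 => [/eqP|k _]; first by rewrite eq_sym oner_eq0.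
  by have := rU0 k; rewrite !mxE => ->; rewrite mul0r.
apply: (@map_mx_inj _ _ toC); rewrite map_horner_mx -/C map_mx0 defC.
rewrite horner_mx_uconjC ?unitmxE// horner_mx_diag.
suff -> : map_mx (horner (map_poly toC p)) d = 0 by rewrite linear0 mulmx0 mul0mx.
apply/rowP => i; rewrite !mxE fE horner_map p0 ?rmorph0//.
by apply/mapP; exists i; rewrite ?mem_enum.
Qed.

Lemma poly_interpolation (s : seq R) (f : R -> R) :
  exists p : {poly R}, {in s, forall a, p.[a] = f a}.
Proof.
elim: s => [|a s [p pE]]; first by exists 0.
have [as_|as_] := boolP (a \in s).
  by exists p => b; rewrite inE => /predU1P[->|]; exact: pE.
pose q := \prod_(b <- s) ('X - b%:P).
have qs b : (q.[b] == 0) = (b \in s).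
  by rewrite -[_ == 0]/(root q b) root_prod_XsubC.
(* Newton interpolation: the correction vanishes at the earlier nodes and fixes the value at [a]. *)
exists (p + ((f a - p.[a]) / q.[a]) *: q) => b; rewrite inE hornerD hornerZ.
move=> /predU1P[->|bs].
  by rewrite divfK ?qs// addrC subrK.
by have := qs b; rewrite bs => /eqP ->; rewrite mulr0 addr0 pE.
Qed.

Lemma horner_mx_sym n (B : 'M[R]_n.+1) p :
  B^T = B -> (horner_mx B p)^T = horner_mx B p.
Proof.
move=> sB; elim/poly_ind: p => [|p c IH]; first by rewrite rmorph0 trmx0.
rewrite rmorphD rmorphM /= horner_mx_X horner_mx_C linearD /= tr_scalar_mx.
congr (_ + _); rewrite trmx_mul IH sB.
suff : comm_mx B (horner_mx B p) by [].
exact: comm_mx_horner.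
Qed.

(** Take [L = p(B)] with [p] interpolating the fourth root on the spectrum; then [p^4 - X] vanishes
    there. A fourth root is used because [L *m L], the square of a symmetric matrix, is visibly
    positive semidefinite. *)
Lemma psdmx_root4 n (B : 'M[R]_n.+1) : B^T = B ->
    (forall a, eigenvalue B a -> 0 <= a) ->
  exists2 L : 'M[R]_n.+1, L^T = L & (L *m L) *m (L *m L) = B.
Proof.
move=> sB posB; have [s sE s0] := symmx_split sB.
have [p pE] := poly_interpolation s (fun a => Num.sqrt (Num.sqrt a)).
exists (horner_mx B p); first exact: horner_mx_sym.
have mxM q r : horner_mx B q *m horner_mx B r = horner_mx B (q * r).
  by rewrite rmorphM.
apply/eqP; rewrite !mxM -subr_eq0 -[X in _ - X](horner_mx_X B) -rmorphB /=.
apply/eqP/s0 => a as_.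
have a0 : 0 <= a by apply: posB; exact: sE.
rewrite hornerD hornerN hornerX !hornerM pE// -!expr2.
by rewrite sqr_sqrtr ?sqrtr_ge0// sqr_sqrtr ?subrr.
Qed.
End SpectralTheorem.

(** * Dot product, positive definite square roots, and the Rayleigh quotient *)

Section EuclideanGeometry.
Variable R : realType.

Definition dot n (u v : 'cV[R]_n) : R := (u^T *m v) 0 0.

Lemma dotE n (u v : 'cV[R]_n) : dot u v = \sum_i u i 0 * v i 0.
Proof. by rewrite /dot mxE; apply: eq_bigr => i _; rewrite mxE. Qed.

Lemma dotC n (u v : 'cV[R]_n) : dot u v = dot v u.
Proof. by rewrite !dotE; apply: eq_bigr => i _; rewrite mulrC. Qed.

Lemma dotDr n (u v w : 'cV[R]_n) : dot u (v + w) = dot u v + dot u w.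
Proof. by rewrite /dot mulmxDr mxE. Qed.

Lemma dotZr n a (u v : 'cV[R]_n) : dot u (a *: v) = a * dot u v.
Proof. by rewrite /dot -scalemxAr mxE. Qed.

Lemma dotZl n a (u v : 'cV[R]_n) : dot (a *: u) v = a * dot u v.
Proof. by rewrite dotC dotZr dotC. Qed.

Lemma dotNr n (u v : 'cV[R]_n) : dot u (- v) = - dot u v.
Proof. by rewrite -scaleN1r dotZr mulN1r. Qed.

Lemma dotBr n (u v w : 'cV[R]_n) : dot u (v - w) = dot u v - dot u w.
Proof. by rewrite dotDr dotNr. Qed.

Lemma dotBl n (u v w : 'cV[R]_n) : dot (u - v) w = dot u w - dot v w.
Proof. by rewrite dotC dotBr !(dotC w). Qed.

Lemma dotMl m n (M : 'M[R]_(m, n)) u v : dot (M *m u) v = dot u (M^T *m v).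
Proof. by rewrite /dot trmx_mul mulmxA. Qed.

Lemma dot_ge0 n (u : 'cV[R]_n) : 0 <= dot u u.
Proof. by rewrite dotE sumr_ge0// => i _; rewrite -expr2 sqr_ge0. Qed.

Lemma dot_eq0 n (u : 'cV[R]_n) : (dot u u == 0) = (u == 0).
Proof.
rewrite dotE psumr_eq0 => [|i _]; last by rewrite -expr2 sqr_ge0.
apply/allP/eqP => [u0|-> i _]; last by rewrite mxE mulr0 eqxx.
apply/colP => i; rewrite mxE; apply/eqP.
by have := u0 i; rewrite mem_index_enum mulf_eq0 orbb => /(_ isT).
Qed.

Lemma dot_gt0 n (u : 'cV[R]_n) : (0 < dot u u) = (u != 0).
Proof. by rewrite lt_neqAle dot_ge0 andbT eq_sym dot_eq0. Qed.

Lemma dot_delta n (M : 'M[R]_n) i j :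
  dot (delta_mx i 0) (M *m delta_mx j 0) = M i j.
Proof. by rewrite /dot trmx_delta -colE -rowE !mxE. Qed.

Lemma dot_delta1 n (i : 'I_n) : dot (delta_mx i 0) (delta_mx i 0) = 1.
Proof. by have := dot_delta 1%:M i i; rewrite mul1mx mxE eqxx. Qed.

Lemma posdefmxE n (B : 'M[R]_n) :
  posdefmx B <-> B^T = B /\ forall v, v != 0 -> 0 < dot v (B *m v).
Proof. by split=> -[sB pB]; split=> // v /pB; rewrite /dot mulmxA. Qed.

Lemma posdef_unit n (B : 'M[R]_n) : posdefmx B -> B \in unitmx.
Proof.
move=> /posdefmxE[sB pB]; rewrite -row_free_unit -kermx_eq0.
apply/rowV0P => v /sub_kermxP vB; apply/eqP; apply: contraT => v0.
have := pB v^T; rewrite trmx_eq0 v0 /dot trmxK mulmxA vB mul0mx mxE ltxx.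
by move=> /(_ isT).
Qed.

Lemma posdef_inv n (B : 'M[R]_n) : posdefmx B -> posdefmx (invmx B).
Proof.
move=> hB; have Bu := posdef_unit hB; move: hB => /posdefmxE[sB pB].
apply/posdefmxE; split=> [|v v0]; first by rewrite trmx_inv sB.
have := pB (invmx B *m v); rewrite mulKVmx// dotC; apply.
by apply: contraNneq v0 => /(congr1 (mulmx B)); rewrite mulKVmx// mulmx0 => ->.
Qed.

Lemma psd_eigenvalue n (B : 'M[R]_n) a : (forall v, 0 <= dot v (B *m v)) ->
  B^T = B -> eigenvalue B a -> 0 <= a.
Proof.
move=> pB sB /eigenvalueP[v vB v0]; have := pB v^T.
rewrite -sB -trmx_mul vB linearZ /= dotZr pmulr_lge0// dot_gt0.
by rewrite trmx_eq0.
Qed.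

Lemma posdef_sqrt_ex n (B : 'M[R]_n) : posdefmx B ->
  exists C, posdefmx C /\ C *m C = B.
Proof.
case: n B => [|n] B hB.
  exists B; split=> //; by apply/matrixP => -[].
move: (hB) => /posdefmxE[sB pB].
have posB a : eigenvalue B a -> 0 <= a.
  apply: psd_eigenvalue => // v.
  by have [->|/pB/ltW//] := eqVneq v 0; rewrite mulmx0 /dot mulmx0 mxE.
have [L sL LB] := psdmx_root4 sB posB.
exists (L *m L); split=> //; apply/posdefmxE; split; first by rewrite trmx_mul sL.
move=> v v0; rewrite -mulmxA -{1}sL -dotMl dot_gt0; apply: contraTneq (pB v v0) => Lv.
by rewrite -LB -!mulmxA Lv !mulmx0 /dot mulmx0 mxE ltxx.
Qed.

Lemma posdef_sqrtP n (B : 'M[R]_n) : posdefmx B ->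
  posdefmx (posdef_sqrt B) /\ posdef_sqrt B *m posdef_sqrt B = B.
Proof.
move=> hB.
exact: (@xgetPex _ 0 [set C | posdefmx C /\ C *m C = B] (posdef_sqrt_ex hB)).
Qed.

(* For [X = C - D], [C X + X D = 0] forces [tr (X C X) + tr (X D X) = 0], a sum
   of nonnegative terms. *)
Lemma posdef_sqrt_inj n (C D : 'M[R]_n) : posdefmx C -> posdefmx D ->
  C *m C = D *m D -> C = D.
Proof.
move=> /posdefmxE[sC pC] /posdefmxE[sD pD] CD.
pose X := C - D; have sX : X^T = X by rewrite /X linearB /= sC sD.
have XCD : C *m X + X *m D = 0.
  by rewrite /X mulmxBr mulmxBl CD addrA subrK subrr.
have ge0 (M : 'M[R]_n) : (forall v, v != 0 -> 0 < dot v (M *m v)) ->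
    forall i, 0 <= (X *m M *m X) i i.
  move=> pM i; rewrite -dot_delta -!mulmxA -{1}sX -dotMl.
  set v := X *m _; have [->|/pM/ltW//] := eqVneq v 0.
  by rewrite mulmx0 /dot mulmx0 mxE.
have trge0 M : (forall v, v != 0 -> 0 < dot v (M *m v)) -> 0 <= \tr (X *m M *m X).
  by move=> /ge0 M0; exact: sumr_ge0.
have tr0 : \tr (X *m C *m X) + \tr (X *m D *m X) = 0.
  rewrite (mxtrace_mulC (X *m D)) -linearD /= -mulmxA -mulmxDr XCD mulmx0.
  exact: linear0.
have trC : \tr (X *m C *m X) = 0.
  apply/eqP; move/eqP: tr0; rewrite paddr_eq0; [by case/andP|exact: trge0..].
apply/eqP; rewrite -subr_eq0 -/X; apply/eqP/matrixP => i j.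
(* The diagonal entry of [X C X] at [j] is the form of [C] at [X e_j]; its vanishing forces
   [X e_j = 0]. *)
have : col j X == 0.
  move/eqP: trC; rewrite psumr_eq0 => [/allP/(_ j)|k _]; last exact: ge0.
  rewrite mem_index_enum -dot_delta -!mulmxA -{1}sX -dotMl -colE => /(_ isT).
  by apply: contraTT => /pC; rewrite lt_neqAle eq_sym => /andP[].
by move=> /eqP/colP/(_ i); rewrite !mxE.
Qed.

(** Both sides are positive definite roots of [invmx B], so uniqueness applies. This links the
    [B^(1/2)] of the norm with the [B^(-1/2)] of the rate. *)
Lemma posdef_sqrt_inv n (B : 'M[R]_n) : posdefmx B ->
  posdef_sqrt (invmx B) = invmx (posdef_sqrt B).
Proof.
move=> hB; have [p1 e1] := posdef_sqrtP hB.
have [p2 e2] := posdef_sqrtP (posdef_inv hB).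
apply: posdef_sqrt_inj => //; first exact: posdef_inv.
rewrite e2; move: p1 e1; move: (posdef_sqrt B) => C p1 e1.
apply: (can_inj (mulKmx (posdef_unit hB))); rewrite mulmxV ?posdef_unit//.
by rewrite -e1 -mulmxA mulKVmx ?posdef_unit// mulmxV ?posdef_unit.
Qed.

(** The spectrum is a nonempty finite list, so the infimum is its least element [a]. Then [M - a]
    has nonnegative spectrum, hence is the square of a symmetric matrix, and its quadratic form is a
    squared norm. *)
Lemma rayleigh n (M : 'M[R]_n) : (0 < n)%N -> M^T = M ->
  eigenvalue M (lambda_min M) /\
  forall v, lambda_min M * dot v v <= dot v (M *m v).
Proof.
case: n M => // n M _ sM; have [s sE s0] := symmx_split sM.
(* The product of the [X - b] over [s] annihilates [M], so each eigenvalue of [M] is one of its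
   roots. *)
have ps a : eigenvalue M a -> a \in s.
  move=> /eigenvalueP[v vM v0]; pose p := \prod_(b <- s) ('X - b%:P).
  have /s0 p0 : {in s, forall b, p.[b] = 0}.
    by move=> b bs; apply/eqP; rewrite -[_ == 0]/(root p b) root_prod_XsubC.
  rewrite -root_prod_XsubC -/p; apply/eqP.
  have vp q : v *m horner_mx M q = q.[a] *: v.
    elim/poly_ind: q => [|q c IH]; first by rewrite rmorph0 mulmx0 hornerC scale0r.
    rewrite rmorphD rmorphM /= horner_mx_X horner_mx_C mulmxDr mulmxA IH.
    by rewrite -scalemxAl vM scalerA mul_mx_scalar hornerMXaddC scalerDl.
  apply/eqP; have /esym/eqP := vp p; rewrite p0 mulmx0 scaler_eq0 (negPf v0).
  by rewrite orbF.
(* If [s] were empty, the constant polynomial 1 would annihilate [M]. *)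
have [a0 a0s] : exists a, a \in s.
  case: s s0 {sE ps} => [|a s] s0; last by exists a; rewrite mem_head.
  have /matrixP/(_ 0 0)/eqP : horner_mx M 1 = 0.
    by apply: s0 => b; rewrite in_nil.
  by rewrite rmorph1 !mxE eqxx oner_eq0.
have [a as_ aP] : exists2 a, a \in s & {in s, forall b, a <= b}.
  move: a0s; clear; elim: s a0 => // c [|e s] IH a0 _.
    by exists c; rewrite ?mem_head// => b; rewrite inE => /eqP ->.
  have [a aS aP] := IH e (mem_head _ _).
  have [ca|ca] := leP c a; [exists c | exists a] => [|b||b].
  - exact: mem_head.
  - by rewrite inE => /predU1P[->//|/aP]; exact: le_trans.
  - by rewrite inE aS orbT.
  - by rewrite inE => /predU1P[->|/aP//]; exact: ltW.
have lE : lambda_min M = a.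
  apply/le_anti/andP; split.
    apply: ge_inf; last exact: sE.
    by exists a => b /= /ps/aP.
  apply: lb_le_inf; first by exists a; exact: sE.
  by move=> b /= /ps/aP.
rewrite lE; split=> [|v]; first exact: sE.
have sMa : (M - a%:M)^T = M - a%:M by rewrite linearB /= sM tr_scalar_mx.
have [|L sL LE] := psdmx_root4 sMa.
  move=> b /eigenvalueP[w wM w0]; have : eigenvalue M (b + a).
    apply/eigenvalueP; exists w => //; rewrite scalerDl -wM mulmxBr.
    by rewrite mul_mx_scalar subrK.
  by move=> /ps/aP; rewrite lerDr.
rewrite -subr_ge0 -dotZr -dotBr -[a *: v]mul_scalar_mx -mulmxBl -LE.
by rewrite -!mulmxA -{1}sL -dotMl -{2}sL -dotMl; exact: dot_ge0.
Qed.
End EuclideanGeometry.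

(** * The spectral norm and its characterization by a bilinear inequality *)

Section SpectralNorm.
Variables (R : realType) (n : nat).
Implicit Types (M K W : 'M[R]_n) (u v : 'cV[R]_n).

Lemma l2normE v : l2norm v = Num.sqrt (dot v v).
Proof. by rewrite /l2norm dotE; under eq_bigr do rewrite expr2. Qed.

Lemma l2norm_sqr v : l2norm v ^+ 2 = dot v v.
Proof. by rewrite l2normE sqr_sqrtr ?dot_ge0. Qed.

Lemma l2norm_ge0 v : 0 <= l2norm v.
Proof. by rewrite l2normE sqrtr_ge0. Qed.

Lemma l2norm_le v c : 0 <= c -> (l2norm v <= c) = (dot v v <= c ^+ 2).
Proof.
by move=> c0; rewrite -(@ler_pXn2r _ 2%N)// ?nnegrE ?l2norm_ge0// l2norm_sqr.
Qed.

(** The supremum defining the norm is meaningful only for a set bounded above. The bound is the root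
    of the largest eigenvalue of [M^T M], obtained as minus the least eigenvalue of its opposite. *)
Lemma bounded_mulmx M : exists2 c : R, 0 <= c &
  forall v, l2norm v = 1 -> l2norm (M *m v) <= c.
Proof.
have [n0|n_gt0] := posnP n.
  exists 0 => // v; rewrite l2normE dotE big1 => [|[i i_n] _].
    by rewrite sqrtr0 => /esym/eqP; rewrite oner_eq0.
  by exfalso; rewrite n0 in i_n.
have sMM : (- (M^T *m M))^T = - (M^T *m M).
  by rewrite linearN /= trmx_mul trmxK.
have [_ ray] := rayleigh n_gt0 sMM.
exists (Num.sqrt (Num.max 0 (- lambda_min (- (M^T *m M))))).
  exact: sqrtr_ge0.
move=> v v1; rewrite l2norm_le ?sqrtr_ge0// sqr_sqrtr ?le_max ?lexx//.
have := ray v; rewrite -l2norm_sqr v1 expr1n mulr1 mulNmx -mulmxA.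
rewrite dotNr -dotMl lerNr => ->; by rewrite orbT.
Qed.

Lemma unit_vector_ex : (0 < n)%N -> exists v, l2norm v = 1.
Proof.
move=> n0; exists (delta_mx (Ordinal n0) 0).
by rewrite l2normE dot_delta1 sqrtr1.
Qed.

Lemma spectral_norm_ub M v : l2norm v = 1 -> l2norm (M *m v) <= spectral_norm M.
Proof.
move=> v1; apply: ub_le_sup; last by exists v.
by have [c _ cP] := bounded_mulmx M; exists c => _ [w w1 <-]; exact: cP.
Qed.

Lemma spectral_norm_ge0 M : 0 <= spectral_norm M.
Proof.
have [n0|n_gt0] := posnP n; last first.
  have [v v1] := unit_vector_ex n_gt0.
  exact: le_trans (l2norm_ge0 _) (spectral_norm_ub M v1).
(* In dimension 0 there is no unit vector and [sup] takes its default value 0. *)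
rewrite /spectral_norm sup_out// => -[[_ [v v1 _]] _].
move: v1; rewrite /= l2normE dotE big1 => [|[i i_n] _].
  by rewrite sqrtr0 => /esym/eqP; rewrite oner_eq0.
by exfalso; rewrite n0 in i_n.
Qed.

(** For [0 <= c] and [0 < n] this is equivalent to [spectral_norm M <= c]. Unlike the norm, it is
    linear in [M] and [c], so it passes directly through expectations. *)
Definition bilinear_bound M c :=
  forall u v, 2 * dot u (M *m v) <= c * (dot u u + dot v v).

(** One direction expands [0 <= |c u - M v|^2]; the other takes [u = c^-1 M v]. The division by [c]
    is why [c = 0] is treated apart. *)
Lemma bilinear_boundP M c : 0 <= c ->
  bilinear_bound M c <-> forall v, dot (M *m v) (M *m v) <= c ^+ 2 * dot v v.
Proof.
move=> c0; split=> [Mc v|Mc u v]; last first.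
  have [c_eq0|c_neq0] := eqVneq c 0.
    have : M *m v == 0.
      rewrite -dot_eq0 eq_le dot_ge0 andbT.
      by have := Mc v; rewrite c_eq0 expr0n mul0r.
    by move=> /eqP ->; rewrite -{1}(scale0r 0) dotZr mul0r mulr0 c_eq0 mul0r.
  have c_gt0 : 0 < c by rewrite lt_neqAle eq_sym c_neq0.
  have := dot_ge0 (c *: u - M *m v).
  rewrite dotBr !dotBl !dotZl !dotZr (dotC _ u) => H.
  by rewrite -(ler_pM2l c_gt0); have := Mc v; lra.
have [c_eq0|c_neq0] := eqVneq c 0.
  have := Mc (M *m v) v; rewrite c_eq0 expr0n /= !mul0r; lra.
have c_gt0 : 0 < c by rewrite lt_neqAle eq_sym c_neq0.
have := Mc (c^-1 *: (M *m v)) v; rewrite !dotZl dotZr => H.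
rewrite -(@ler_pM2l _ c^-1) ?invr_gt0//.
rewrite [leRHS]mulrA expr2 mulKf//.
set x := dot (M *m v) _ in H *; set y := dot v v in H *.
have : c * (c^-1 * (c^-1 * x) + y) = c^-1 * x + c * y by rewrite mulrDr mulVKf.
by move=> E; rewrite E in H; lra.
Qed.

Lemma spectral_norm_bilinear M : bilinear_bound M (spectral_norm M).
Proof.
apply/(bilinear_boundP _ (spectral_norm_ge0 M)) => v.
have [->|v0] := eqVneq v 0.
  by rewrite mulmx0 -(scale0r 0) dotZr mul0r mulr_ge0 ?sqr_ge0 ?dot_ge0.
have nv0 : l2norm v != 0 by rewrite -sqrf_eq0 l2norm_sqr dot_eq0.
have nv : l2norm ((l2norm v)^-1 *: v) = 1.
  apply/eqP; rewrite -(@eqrXn2 _ 2%N)// ?l2norm_ge0// l2norm_sqr dotZl dotZr.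
  by rewrite mulrA -l2norm_sqr -invfM -expr2 mulVf ?expr1n// expf_neq0.
have := spectral_norm_ub M nv.
rewrite l2norm_le ?spectral_norm_ge0// -scalemxAr dotZl dotZr mulrA -invfM -expr2.
by rewrite l2norm_sqr ler_pdivrMl ?dot_gt0// mulrC.
Qed.

Lemma spectral_norm_le M c : (0 < n)%N -> 0 <= c -> bilinear_bound M c ->
  spectral_norm M <= c.
Proof.
move=> n0 c0 /(bilinear_boundP _ c0) Mc; apply: ge_sup.
  by have [v v1] := unit_vector_ex n0; exists (l2norm (M *m v)), v.
move=> _ [v /= v1 <-]; rewrite l2norm_le//; have := Mc v.
by rewrite -[X in _ * X]l2norm_sqr v1 expr1n mulr1.
Qed.

(** Nonnegativity of the form at [u - v] gives [2 u.K v <= u.K u + v.K v]. *)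
Lemma bilinear_bound_psd K c : K^T = K ->
    (forall v, 0 <= dot v (K *m v)) -> (forall v, dot v (K *m v) <= c * dot v v) ->
  bilinear_bound K c.
Proof.
move=> sK pK Kc u v; have := pK (u - v).
rewrite mulmxBr !dotBr !dotBl -(dotC (K *m u) v) dotMl sK.
by have := Kc u; have := Kc v; lra.
Qed.

Lemma bilinear_bound_mul K W c d : 0 <= c -> 0 <= d ->
  bilinear_bound K c -> bilinear_bound W d -> bilinear_bound (K *m W) (c * d).
Proof.
move=> c0 d0 /(bilinear_boundP _ c0) Kc /(bilinear_boundP _ d0) Wd.
apply/(bilinear_boundP _ (mulr_ge0 c0 d0)) => v; rewrite -mulmxA.
apply: (le_trans (Kc _)); rewrite exprMn -[leRHS]mulrA.
by apply: ler_wpM2l; [exact: sqr_ge0 | exact: Wd].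
Qed.
End SpectralNorm.

(** * Bounded random variables and independence *)

Section BoundedMeasurable.
Context d (T : measurableType d) (R : realType).
Implicit Types f g : T -> R.

(** Bounded measurable functions form an algebra on which the expectation under a probability is
    defined and linear, so integrability need not be rechecked for sums and products. *)
Definition bmf f := measurable_fun setT f /\ exists c : R, forall x, `|f x| <= c.

Lemma bmf_cst (c : R) : bmf (fun=> c).
Proof. by split; [exact: measurable_cst|exists `|c|]. Qed.

Lemma bmfD f g : bmf f -> bmf g -> bmf (fun x => f x + g x).
Proof.
move=> [mf [c fc]] [mg [e ge]]; split; first exact: measurable_funD.
by exists (c + e) => x; rewrite (le_trans (ler_normD _ _))// lerD.
Qed.

Lemma bmfM f g : bmf f -> bmf g -> bmf (fun x => f x * g x).
Proof.
move=> [mf [c fc]] [mg [e ge]]; split; first exact: measurable_funM.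
by exists (c * e) => x; rewrite normrM ler_pM.
Qed.

Lemma bmfZ a f : bmf f -> bmf (fun x => a * f x).
Proof. exact/bmfM/bmf_cst. Qed.

Lemma bmfB f g : bmf f -> bmf g -> bmf (fun x => f x - g x).
Proof.
move=> bf bg; under eq_fun do rewrite -mulN1r.
exact/bmfD/bmfZ.
Qed.

Lemma bmf_sum (I : Type) (r : seq I) (F : I -> T -> R) :
  (forall i, bmf (F i)) -> bmf (fun x => \sum_(i <- r) F i x).
Proof.
move=> bF; elim: r => [|i r IH].
  by under eq_fun do rewrite big_nil; exact: bmf_cst.
by under eq_fun do rewrite big_cons; exact: bmfD.
Qed.

Lemma bmf_indic (A : set T) : measurable A -> bmf (\1_A).
Proof.
move=> mA; split; first exact: measurable_indic.
by exists 1 => x; rewrite indicE; case: (x \in A); rewrite ?normr1 ?normr0.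
Qed.
End BoundedMeasurable.

Lemma bmf_comp d d' (T : measurableType d) (T' : measurableType d')
    (R : realType) (X : T -> T') (f : T' -> R) : measurable_fun setT X -> bmf f -> bmf (f \o X).
Proof.
move=> mX [mf [c fc]]; split; first exact: measurableT_comp.
by exists c => x; exact: fc.
Qed.

(** * Expectation of bounded random variables *)

Section Mean.
Context d (T : measurableType d) (R : realType) (P : probability T R).
Implicit Types f g : T -> R.

Local Notation E f := (Rintegral P setT f).

Lemma bmf_integrable f : bmf f -> P.-integrable setT (EFin \o f).
Proof.
move=> [mf [c fc]]; apply: measurable_bounded_integrable => //.
  exact: le_lt_trans (probability_le1 P measurableT) (ltry 1).
by exists c; split => [|x /ltW cx w _]; [exact: num_real|exact: le_trans (fc w) cx].
Qed.

Lemma mean_cst (c : R) : E (fun=> c) = c.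
Proof. by rewrite Rintegral_cst//= probability_setT mulr1. Qed.

Lemma meanD f g : bmf f -> bmf g -> E (fun x => f x + g x) = E f + E g.
Proof. by move=> bf bg; rewrite RintegralD//; exact: bmf_integrable. Qed.

Lemma meanZ a f : bmf f -> E (fun x => a * f x) = a * E f.
Proof. by move=> bf; rewrite RintegralZl//; exact: bmf_integrable. Qed.

Lemma meanB f g : bmf f -> bmf g -> E (fun x => f x - g x) = E f - E g.
Proof.
move=> bf bg; rewrite -mulN1r -meanZ// -meanD//; last exact: bmfZ.
by apply: eq_Rintegral => x _; rewrite mulN1r.
Qed.

Lemma mean_sum (I : Type) (r : seq I) (F : I -> T -> R) :
  (forall i, bmf (F i)) -> E (fun x => \sum_(i <- r) F i x) = \sum_(i <- r) E (F i).
Proof.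
move=> bF; elim: r => [|i r IH].
  by under eq_Rintegral do rewrite big_nil; rewrite mean_cst big_nil.
under eq_Rintegral do rewrite big_cons.
by rewrite meanD ?IH ?big_cons//; exact: bmf_sum.
Qed.

Lemma mean_le f g : bmf f -> bmf g -> (forall x, f x <= g x) -> E f <= E g.
Proof. by move=> bf bg fg; apply: le_Rintegral => //; exact: bmf_integrable. Qed.

Lemma mean_bound f c : bmf f -> (forall x, `|f x| <= c) -> `|E f| <= c.
Proof.
move=> bf fc; rewrite ler_norml; apply/andP; split.
  rewrite -[leLHS]mean_cst; apply: mean_le => // [|x]; first exact: bmf_cst.
  by have := fc x; rewrite ler_norml => /andP[].
rewrite -[leRHS]mean_cst; apply: mean_le => // [|x]; first exact: bmf_cst.
by have := fc x; rewrite ler_norml => /andP[].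
Qed.

Lemma mean_indic (A : set T) : measurable A -> E (\1_A) = fine (P A).
Proof. by move=> mA; rewrite /Rintegral integral_indic// setIT. Qed.

(** Here [f] may be unbounded on a null set, as the iterates are where a Gram matrix is singular. *)
Lemma ae_integrable f g : measurable_fun setT f -> bmf g ->
  {ae P, forall w, f w = g w} ->
  P.-integrable setT (EFin \o f).
Proof.
move=> mf bg fg; apply/integrableP; split; first exact/measurable_EFinP.
have /integrableP[_] := bmf_integrable bg.
rewrite (@ae_eq_integral _ _ _ P setT (fun x => `|(EFin \o f) x|%E))//.
- by do 2 apply: measurableT_comp => //; case: bg.
- by do 2 apply: measurableT_comp => //.
- by apply: filterS fg => w /= -> _.
Qed.

Lemma mean_ae f g : measurable_fun setT f -> bmf g ->
  {ae P, forall w, f w = g w} -> E f = E g.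
Proof.
move=> mf [mg _] fg; rewrite /Rintegral; congr fine.
apply: ae_eq_integral => //; [exact/measurable_EFinP..|].
by apply: filterS fg => w /= -> _.
Qed.

Lemma mean_eq_distribution d' (T' : measurableType d') (X Y : {RV P >-> T'})
    (f : T' -> R) :
  (forall U, measurable U -> distribution P X U = distribution P Y U) ->
  bmf f -> E (f \o X) = E (f \o Y).
Proof.
move=> XY bf; rewrite /Rintegral; congr fine.
have ii (Z : {RV P >-> T'}) :
    (\int[distribution P Z]_y (f y)%:E = \int[P]_x (f (Z x))%:E)%E.
  rewrite (integral_distribution (X := Z) (f := EFin \o f))//.
    by apply/measurable_EFinP; case: bf.
  by have := bmf_integrable (bmf_comp (measurable_funPT Z) bf).
by rewrite -!ii; apply: eq_measure_integral => U mU _; exact: XY.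
Qed.
End Mean.

(* Peeling off [(c / 2) * \1_(f >= c / 2)] halves the range of [f >= 0] without
   changing [L f], so continuity in sup norm makes [L f] vanish. *)
Lemma bmf_functional_eq0 d (T : measurableType d) (R : realType)
    (L : (T -> R) -> R) (K : R) :
  (forall f g, bmf f -> bmf g -> L (fun x => f x - g x) = L f - L g) ->
  (forall a f, bmf f -> L (fun x => a * f x) = a * L f) ->
  (forall f (c : R), bmf f -> (forall x, `|f x| <= c) -> `|L f| <= K * c) ->
  (forall A, measurable A -> L (\1_A) = 0) ->
  forall f, bmf f -> L f = 0.
Proof.
move=> LB LZ Lb L1.
have halves m f c : bmf f -> (forall x, 0 <= f x <= c) -> `|L f| <= K * (c / 2 ^+ m).
  elim: m f c => [|m IH] f c bf f0.
    rewrite expr0 divr1; apply: Lb => // x.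
    by have /andP[? ?] := f0 x; rewrite ger0_norm.
  pose A := [set x | c / 2 <= f x].
  have mA : measurable A.
    rewrite -[A]setTI; have [mf _] := bf.
    have := mf measurableT `[c / 2, +oo[%classic (measurable_itv _).
    by rewrite /preimage /=; under eq_set do rewrite in_itv /= andbT.
  have bA : bmf (\1_A : T -> R) by exact: bmf_indic.
  have Lf : L (fun x => f x - c / 2 * \1_A x) = L f.
    by rewrite LB ?LZ ?L1 ?mulr0 ?subr0//; exact: bmfZ.
  rewrite -Lf.
  have -> : c / 2 ^+ m.+1 = (c / 2) / 2 ^+ m by rewrite exprS invfM mulrA.
  apply: IH => [|x]; first by apply: bmfB => //; exact: bmfZ.
  have /andP[fx0 fxc] := f0 x; rewrite indicE.
  have [|] := boolP (x \in A); rewrite ?inE ?notin_setE /A /= => xA.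
    by rewrite mulr1; lra.
  by rewrite mulr0; move/negP: xA; rewrite -ltNge; lra.
have pos f c : bmf f -> (forall x, 0 <= f x <= c) -> L f = 0.
  move=> bf fc; apply/eqP; rewrite -normr_le0; apply/ler_addgt0Pl => e e0.
  rewrite addr0.
  have lim : (fun m => K * (c / 2 ^+ m)) @ \oo --> (0 : R).
    rewrite -(mulr0 K) -[X in K * X](mulr0 c).
    apply: cvgMr; apply: cvgMr.
    under eq_fun do rewrite -exprVn.
    by apply: cvg_expr; rewrite ger0_norm// invf_lt1// ltr1n.
  have [m _ Hm] := cvgr_lt _ lim _ e0.
  exact/ltW/(le_lt_trans (halves m f c bf fc))/(Hm m)/leqnn.
move=> f bf; have [_ [c fc]] := bf.
(* A constant is a multiple of the indicator of the whole space. A bounded [f] of any sign is then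
   reached through [c - f], whose values lie between 0 and [c + c]. *)
have c1 : L (fun=> c) = 0.
  have := LZ c _ (@bmf_indic _ T R setT measurableT); rewrite L1// mulr0 => <-.
  by congr L; apply/funext => x; rewrite indicT mulr1.
have := LB _ _ (bmf_cst T c) bf; rewrite c1 (pos _ (c + c)).
- by rewrite sub0r => /esym/eqP; rewrite oppr_eq0 => /eqP.
- exact/bmfB/bf/bmf_cst.
- move=> x; have := fc x; rewrite ler_norml => /andP[fx1 fx2].
  by rewrite subr_ge0 fx2 lerD2l lerNl.
Qed.

(** * Independence of the current iterate from the fresh draw *)

Section Independence.
Context d (T : measurableType d) (R : realType) (P : probability T R).
Context d' (T' : measurableType d') (X : nat -> {RV P >-> T'}).
Hypothesis indX : mutually_independent X.
Local Notation E f := (Rintegral P setT f).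

Definition cylinder (J : seq nat) (U : nat -> set T') :=
  \bigcap_(j in [set` J]) (X j @^-1` U j).

Lemma measurable_cylinder J U : (forall j, measurable (U j)) ->
  measurable (cylinder J U).
Proof.
move=> mU; apply: fin_bigcap_measurable; first exact: finite_seq.
by move=> j _; rewrite -[X in measurable X]setTI; exact: measurable_funPT.
Qed.

(* [g] factors from the draws of index at least [k]; instantiated at functions
   of the first [k] draws. *)
Definition past (k : nat) (g : T -> R) : Prop := bmf g /\
  forall J U, uniq J -> {in J, forall j, (k <= j)%N} ->
    (forall j, measurable (U j)) ->
    E (fun w => g w * \1_(cylinder J U) w) = E g * fine (P (cylinder J U)).

Lemma past_cst k c : past k (fun=> c).
Proof.
split=> [|J U uJ Jk mU]; first exact: bmf_cst.
have mC := measurable_cylinder J mU.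
by rewrite meanZ ?mean_cst ?mean_indic//; exact: bmf_indic.
Qed.

Lemma pastD k g h : past k g -> past k h -> past k (fun w => g w + h w).
Proof.
move=> [bg pg] [bh ph]; split=> [|J U uJ Jk mU]; first exact: bmfD.
have b1 := bmf_indic R (measurable_cylinder J mU).
under eq_Rintegral do rewrite mulrDl.
by rewrite (meanD P (bmfM bg b1) (bmfM bh b1)) pg// ph// meanD// mulrDl.
Qed.

Lemma past_sum k (I : Type) (r : seq I) (F : I -> T -> R) :
  (forall i, past k (F i)) -> past k (fun w => \sum_(i <- r) F i w).
Proof.
move=> pF; elim: r => [|i r IH].
  by under eq_fun do rewrite big_nil; exact: past_cst.
by under eq_fun do rewrite big_cons; exact: pastD.
Qed.

Lemma cylinder_split k J U V : k \notin J -> uniq J ->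
  measurable V -> (forall j, measurable (U j)) ->
  exists2 W, [/\ uniq (k :: J), (forall j, measurable (W j)) &
                 cylinder (k :: J) W = (X k @^-1` V) `&` cylinder J U] &
    fine (P (cylinder (k :: J) W)) = fine (P (X k @^-1` V)) * fine (P (cylinder J U)).
Proof.
move=> kJ uJ mV mU; pose W j := if j == k then V else U j.
have mW j : measurable (W j) by rewrite /W; case: eqP.
have WJ : {in J, forall j, W j = U j}.
  by move=> j jJ; rewrite /W; case: eqP jJ kJ => // -> ->.
exists W.
  split=> //=; first by rewrite kJ.
  apply/seteqP; split=> w /=.
    move=> H; split; first by have := H k (mem_head _ _); rewrite /W eqxx.
    by move=> j /= jJ; have := H j; rewrite /= inE jJ orbT WJ//; apply.
  move=> [Hk HJ] j /=; rewrite inE => /predU1P[->|jJ]; first by rewrite /W eqxx.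
  by rewrite WJ//; exact: HJ.
rewrite /cylinder !indX//=; last by rewrite kJ.
rewrite big_cons {1}/W eqxx -fineM ?fin_num_measure//.
- congr (fine (_ * _)%E); apply: eq_big_seq => j jJ; by rewrite WJ.
- by rewrite -[X in measurable X]setTI; exact: measurable_funPT.
- rewrite -indX//; apply: fin_num_measure; exact: measurable_cylinder.
Qed.

(** The difference of the two sides is a linear functional of [f], continuous in sup norm, so
    indicators suffice. For an indicator, the event on draw [k] joins the cylinder, and the defining
    property of [past k] applies to the indices [k :: J]. *)
Lemma past_factor k g (f : T' -> R) J U : past k g -> bmf f -> uniq J ->
    {in J, forall j, (k < j)%N} -> (forall j, measurable (U j)) ->
  E (fun w => g w * f (X k w) * \1_(cylinder J U) w) =
  E g * E (f \o X k) * fine (P (cylinder J U)).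
Proof.
move=> [bg pg] bf uJ Jk mU.
have bfX h : bmf h -> bmf (h \o X k) by exact: bmf_comp.
have mC := measurable_cylinder J mU.
have b1 := bmf_indic R mC.
have b2 h : bmf h -> bmf (fun w => g w * h (X k w) * \1_(cylinder J U) w).
  by move=> bh; apply: bmfM => //; apply: bmfM => //; exact: bfX.
apply/eqP; rewrite -subr_eq0; apply/eqP.
have [_ [c gc]] := bg.
pose L h := E (fun w => g w * h (X k w) * \1_(cylinder J U) w) -
            E g * E (h \o X k) * fine (P (cylinder J U)).
(* Each of the two terms of [L h] is at most [c] times the sup norm of [h], where [c] bounds [g]. *)
apply: (@bmf_functional_eq0 _ _ _ L (c + c)) => // [h1 h2 bh1 bh2|a h bh|h e bh he|V mV].
- rewrite /L.
  under eq_Rintegral do rewrite mulrBr mulrBl.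
  rewrite (meanB P (b2 _ bh1) (b2 _ bh2)).
  have -> : E ((fun x => h1 x - h2 x) \o X k) = E (h1 \o X k) - E (h2 \o X k).
    by rewrite -meanB//; exact: bfX.
  by ring.
- rewrite /L.
  under eq_Rintegral => w _.
    rewrite (_ : _ * _ = a * (g w * h (X k w) * \1_(cylinder J U) w)); last by ring.
    over.
  rewrite (meanZ P _ (b2 _ bh)).
  have -> : E ((fun x => a * h x) \o X k) = a * E (h \o X k).
    by rewrite -meanZ//; exact: bfX.
  by ring.
- apply: (le_trans (ler_normB _ _)); rewrite mulrDl lerD//.
    apply: mean_bound => [|w]; first exact: b2.
    rewrite -[leRHS]mulr1 !normrM ler_pM// ?mulr_ge0//; first by rewrite ler_pM.
    by rewrite indicE; case: (w \in _); rewrite ?normr1 ?normr0.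
  rewrite !normrM -[leRHS]mulr1 ler_pM// ?mulr_ge0//; first rewrite ler_pM//.
  + exact: mean_bound.
  + by apply: mean_bound => [|w]; [exact: bfX|exact: he].
  + rewrite -mean_indic// mean_bound// => w.
    by rewrite indicE; case: (w \in _); rewrite ?normr1 ?normr0.
have kJ : k \notin J by apply/negP => /Jk; rewrite ltnn.
have [W [ukJ mW WE] PW] := cylinder_split kJ uJ mV mU.
have mXV : measurable (X k @^-1` V).
  by rewrite -[X in measurable X]setTI; exact: measurable_funPT.
have := pg (k :: J) W ukJ; rewrite PW => pgW.
rewrite /L (_ : E (\1_V \o X k) = fine (P (X k @^-1` V))); last by rewrite -mean_indic.
rewrite -mulrA -pgW//; last by move=> j; rewrite inE => /predU1P[->//|/Jk/ltnW].
apply/eqP; rewrite subr_eq0; apply/eqP/eq_Rintegral => w _.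
by rewrite WE indicI /= mulrA.
Qed.

Lemma past_mean k g (f : T' -> R) : past k g -> bmf f ->
  E (fun w => g w * f (X k w)) = E g * E (f \o X k).
Proof.
move=> pg bf; have := @past_factor k g f [::] (fun=> setT) pg bf isT.
rewrite (_ : cylinder _ _ = setT); last by apply/seteqP; split=> // w _ j.
rewrite probability_setT mulr1 => <- //.
by apply: eq_Rintegral => w _; rewrite indicT mulr1.
Qed.

(** The induction step along the iterations: multiplying by a function of draw [k] uses up one more
    draw. *)
Lemma past_mul k g (f : T' -> R) : past k g -> bmf f ->
  past k.+1 (fun w => g w * f (X k w)).
Proof.
move=> pg bf; split=> [|J U uJ Jk mU].
  by case: pg => bg _; apply: bmfM => //; exact: bmf_comp.
by rewrite past_mean//; apply: past_factor.
Qed.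
End Independence.

(** * Random sketches *)

Section EntrywiseContinuity.
Variables (R : realType) (V : topologicalType).

Definition cont_mx m n (F : V -> 'M[R]_(m, n)) :=
  forall i j, continuous (fun v => F v i j).

Lemma continuous_bigsum (I : Type) (r : seq I) (F : I -> V -> R) :
  (forall i, continuous (F i)) -> continuous (fun v => \sum_(i <- r) F i v).
Proof.
move=> cF; elim: r => [|i r IH] v.
  by under eq_fun do rewrite big_nil; exact: cst_continuous.
by under eq_fun do rewrite big_cons; apply: cvgD; [exact: cF | exact: IH].
Qed.

Lemma continuous_bigprod (I : Type) (r : seq I) (F : I -> V -> R) :
  (forall i, continuous (F i)) -> continuous (fun v => \prod_(i <- r) F i v).
Proof.
move=> cF; elim: r => [|i r IH] v.
  by under eq_fun do rewrite big_nil; exact: cst_continuous.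
by under eq_fun do rewrite big_cons; apply: cvgM; [exact: cF | exact: IH].
Qed.

Lemma cont_mx_cst m n (M : 'M[R]_(m, n)) : cont_mx (fun=> M).
Proof. by move=> i j; exact: cst_continuous. Qed.

Lemma cont_mx_tr m n (F : V -> 'M[R]_(m, n)) :
  cont_mx F -> cont_mx (fun v => (F v)^T).
Proof. by move=> cF i j v; under eq_fun do rewrite mxE; exact: cF. Qed.

Lemma cont_mx_mul m n p (F : V -> 'M[R]_(m, n)) (G : V -> 'M[R]_(n, p)) :
  cont_mx F -> cont_mx G -> cont_mx (fun v => F v *m G v).
Proof.
move=> cF cG i j v; under eq_fun do rewrite mxE.
by apply: continuous_bigsum => k w; apply: cvgM; [exact: cF | exact: cG].
Qed.

Lemma continuous_det n (F : V -> 'M[R]_n) :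
  cont_mx F -> continuous (fun v => \det (F v)).
Proof.
move=> cF; apply: continuous_bigsum => s v; apply: cvgM; first exact: cst_continuous.
by apply: continuous_bigprod => i; exact: cF.
Qed.

Lemma cont_mx_adj n (F : V -> 'M[R]_n) :
  cont_mx F -> cont_mx (fun v => \adj (F v)).
Proof.
move=> cF i j v; under eq_fun do rewrite mxE /cofactor.
apply: cvgM; first exact: cst_continuous.
by apply: continuous_det => k l w; under eq_fun do rewrite !mxE; exact: cF.
Qed.
End EntrywiseContinuity.

(** * Measurable functions of a sketch with a random number of columns *)

Section SketchMeasurability.
Variables (R : realType) (n : nat).

Definition tagmx q (M : 'M[R]_(n, q)) : sketch R n :=
  Tagged (fun q => 'M[R]_(n, q)) M.

(** The preimage of an open ray is a countable union over [q] of tagged open sets, each a generator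
    of the sigma-algebra. *)
Lemma sketch_measurable (h : sketch R n -> R) :
  (forall q, continuous (fun M : 'M[R]_(n, q) => h (tagmx M))) ->
  measurable_fun setT h.
Proof.
move=> ch; apply: (measurability (@RGenOInfty.G R)); first exact: RGenOInfty.measurableE.
move=> _ [_ [x ->] <-]; rewrite setTI.
have -> : h @^-1` `]x, +oo[%classic =
    \bigcup_q [set tagmx M | M in [set M : 'M[R]_(n, q) | x < h (tagmx M)]].
  apply/seteqP; split=> [[q M]|_ [q _ [M xM <-]]] /=.
    by rewrite in_itv /= andbT => xM; exists q => //; exists M.
  by rewrite in_itv /= andbT.
apply: bigcupT_measurable => q; apply: sub_sigma_algebra.
exists q, [set M : 'M[R]_(n, q) | x < h (tagmx M)]; split=> //.
have /continuousP/(_ _ (@open_gt _ x)) := ch q.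
by [].
Qed.

Lemma measurable_ncols : measurable_fun setT (fun s : sketch R n => (ncols s)%:R : R).
Proof. by apply: sketch_measurable => q M; exact: cst_continuous. Qed.

(** Inversion is not continuous at 0. Writing it as [x * (x^2)^-1] reduces it to a real power of a
    nonnegative number; at 0 both expressions are 0. *)
Lemma measurable_inv : measurable_fun setT (fun x : R => x^-1).
Proof.
have -> : (fun x : R => x^-1) = (fun x => x * (x ^+ 2) `^ (-1)).
  apply/funext => x; rewrite powR_inv1 ?sqr_ge0//.
  have [->|x0] := eqVneq x 0; first by rewrite invr0 mul0r.
  by rewrite expr2 invfM mulVKf.
apply: measurable_funM => //.
apply: (measurableT_comp (measurable_powR (-1))).
exact: measurable_funX.
Qed.

Lemma cont_tagmx q : @cont_mx R 'M[R]_(n, q) n q id.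
Proof. by move=> i j; exact: coord_continuous. Qed.

Definition gram (A B : 'M[R]_n) (s : sketch R n) :=
  let S := sketchmx s in S^T *m A *m invmx B *m A^T *m S.

(* [Zmx] where the Gram matrix is invertible and [0] elsewhere, as [0^-1 = 0]. *)
Definition Zreg (A B : 'M[R]_n) (s : sketch R n) :=
  let S := sketchmx s in
  (\det (gram A B s))^-1 *: (A^T *m S *m \adj (gram A B s) *m S^T *m A).

Lemma cont_gram (A B : 'M[R]_n) q :
  cont_mx (fun M : 'M[R]_(n, q) => gram A B (tagmx M)).
Proof.
rewrite /gram /=; do ! apply: cont_mx_mul; try exact: cont_mx_cst.
- exact/cont_mx_tr/cont_tagmx.
- exact: cont_tagmx.
Qed.

Lemma measurable_gram_det A B :
  measurable_fun setT (fun s : sketch R n => \det (gram A B s)).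
Proof. by apply: sketch_measurable => q; exact/continuous_det/cont_gram. Qed.

Lemma measurable_gram_detV A B :
  measurable_fun setT (fun s : sketch R n => (\det (gram A B s))^-1).
Proof. exact: measurableT_comp measurable_inv (measurable_gram_det A B). Qed.

Lemma measurable_Zreg (A B : 'M[R]_n) i j : measurable_fun setT (fun s => Zreg A B s i j).
Proof.
under eq_fun do rewrite mxE.
apply: measurable_funM; first exact: measurable_gram_detV.
apply: sketch_measurable => q.
suff : cont_mx (fun M : 'M[R]_(n, q) =>
    A^T *m M *m \adj (gram A B (tagmx M)) *m M^T *m A).
  exact.
do ! apply: cont_mx_mul; try exact: cont_mx_cst.
- exact: cont_tagmx.
- exact/cont_mx_adj/cont_gram.
- exact/cont_mx_tr/cont_tagmx.
Qed.

Lemma Zmx_regular (A B : 'M[R]_n) s : \det (gram A B s) != 0 -> Zmx A B s = Zreg A B s.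
Proof.
move=> d0; rewrite /Zmx /Zreg -/(gram A B s).
have -> : invmx (gram A B s) = (\det (gram A B s))^-1 *: \adj (gram A B s).
  by rewrite /invmx unitmxE unitfE d0.
by rewrite -scalemxAr -!scalemxAl.
Qed.

(** At a singular Gram matrix, [invmx] returns the matrix itself and [Zmx] becomes the polynomial
    expression [N]. The factor [1 - det * det^-1] is the indicator of this singular set, so one
    formula covers both cases. *)
Lemma measurable_Zmx (A B : 'M[R]_n) i j : measurable_fun setT (fun s => Zmx A B s i j).
Proof.
pose N s := A^T *m sketchmx s *m gram A B s *m (sketchmx s)^T *m A.
have -> : (fun s => Zmx A B s i j) = (fun s => Zreg A B s i j +
    (1 - \det (gram A B s) * (\det (gram A B s))^-1) * N s i j).
  apply/funext => s; have [d0|d0] := eqVneq (\det (gram A B s)) 0.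
    rewrite /Zreg d0 invr0 scale0r [X in X + _]mxE add0r mulr0 subr0 mul1r.
    by rewrite /Zmx -/(gram A B s) /invmx unitmxE unitfE d0 eqxx.
  by rewrite Zmx_regular// mulfV// subrr mul0r addr0.
apply: measurable_funD; first exact: measurable_Zreg.
apply: measurable_funM.
  apply: measurable_funB => //; apply: measurable_funM.
    exact: measurable_gram_det.
  exact: measurable_gram_detV.
apply: sketch_measurable => q.
suff : cont_mx (fun M : 'M[R]_(n, q) => A^T *m M *m gram A B (tagmx M) *m M^T *m A).
  exact.
apply: cont_mx_mul; [|exact: cont_mx_cst]; apply: cont_mx_mul.
  apply: cont_mx_mul; last exact: cont_gram.
  by apply: cont_mx_mul; [exact: cont_mx_cst | exact: cont_tagmx].
exact/cont_mx_tr/cont_tagmx.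
Qed.
End SketchMeasurability.

(** * The orthogonal projection behind one sketching step *)

Section Projection.
Variable R : realType.

(** The orthogonal projection onto the column space of [G] when [G] has full column rank, and 0
    otherwise since [0^-1 = 0]. Being symmetric and idempotent thus holds without a rank
    condition. *)
Definition colproj n q (G : 'M[R]_(n, q)) : 'M[R]_n :=
  (\det (G^T *m G))^-1 *: (G *m \adj (G^T *m G) *m G^T).

Lemma colproj_sym n q (G : 'M[R]_(n, q)) : (colproj G)^T = colproj G.
Proof.
rewrite /colproj linearZ /= !trmx_mul trmxK trmx_adj trmx_mul trmxK mulmxA.
by [].
Qed.

Lemma colproj_idem n q (G : 'M[R]_(n, q)) : colproj G *m colproj G = colproj G.
Proof.
have [d0|d0] := eqVneq (\det (G^T *m G)) 0.
  by rewrite /colproj d0 invr0 scale0r mul0mx.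
rewrite /colproj -scalemxAr -scalemxAl; congr (_ *: _).
rewrite -!mulmxA (mulmxA G^T) [(G^T *m G) *m (\adj _ *m _)]mulmxA mul_mx_adj.
by rewrite mul_scalar_mx -!scalemxAr scalerA mulVf// scale1r.
Qed.

Lemma colproj_trace n q (G : 'M[R]_(n, q)) : \det (G^T *m G) != 0 ->
  \tr (colproj G) = q%:R.
Proof.
move=> d0; rewrite /colproj linearZ /= -mulmxA mxtrace_mulC -mulmxA mul_adj_mx.
by rewrite mxtrace_scalar mulrnAr mulVf.
Qed.

(** A kernel vector [v] of [G^T G] satisfies [|G v|^2 = 0], so full column rank makes it vanish. *)
Lemma gram_det_neq0 n q (G : 'M[R]_(n, q)) : \rank G = q -> \det (G^T *m G) != 0.
Proof.
move=> rG; rewrite -unitfE -unitmxE -row_free_unit -kermx_eq0.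
apply/rowV0P => v /sub_kermxP vG; apply/eqP.
have : G *m v^T == 0.
  by rewrite -dot_eq0 dotMl mulmxA /dot trmxK mulmxA vG mul0mx mxE.
rewrite -trmx_eq0 trmx_mul trmxK => /eqP vG0.
have : row_free G^T by rewrite /row_free mxrank_tr rG.
by rewrite -kermx_eq0 => /rowV0P H; apply/eqP/H/sub_kermxP.
Qed.

Lemma colproj_quad n q (G : 'M[R]_(n, q)) v :
  dot v (colproj G *m v) = dot (colproj G *m v) (colproj G *m v).
Proof. by rewrite dotMl colproj_sym mulmxA colproj_idem. Qed.

Lemma colprojC_quad n q (G : 'M[R]_(n, q)) v :
  dot v ((1%:M - colproj G) *m v) =
  dot ((1%:M - colproj G) *m v) ((1%:M - colproj G) *m v).
Proof.
rewrite dotMl linearB /= trmx1 colproj_sym mulmxA; congr (dot v (_ *m v)).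
rewrite mulmxBr mulmx1 mulmxBl mul1mx colproj_idem subrr subr0.
by [].
Qed.

(** A projection lies between 0 and the identity, so the bilinear inequality with constant 1 holds;
    it is evaluated at signed basis vectors. The bound does not depend on [G] or [q]. *)
Lemma colproj_entry n q (G : 'M[R]_(n, q)) i j : `|colproj G i j| <= 1.
Proof.
have psd v : 0 <= dot v (colproj G *m v) by rewrite colproj_quad dot_ge0.
have le1 v : dot v (colproj G *m v) <= 1 * dot v v.
  rewrite mul1r -subr_ge0 -dotBr.
  by have := dot_ge0 ((1%:M - colproj G) *m v); rewrite -colprojC_quad mulmxBl mul1mx.
have H := bilinear_bound_psd (colproj_sym G) psd le1.
rewrite ler_norml; apply/andP; split.
  have := H (- delta_mx i 0) (delta_mx j 0).
  rewrite -scaleN1r !dotZl dotZr dot_delta !dot_delta1; lra.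
have := H (delta_mx i 0) (delta_mx j 0); rewrite dot_delta !dot_delta1; lra.
Qed.

Lemma gram_factor n (A B C : 'M[R]_n) s : C^T = C -> C *m C = invmx B ->
  (C *m A^T *m sketchmx s)^T *m (C *m A^T *m sketchmx s) = gram A B s.
Proof. by move=> sC CC; rewrite !trmx_mul trmxK sC /gram -CC !mulmxA. Qed.

Lemma Zreg_colproj n (A B C : 'M[R]_n) s : C^T = C -> C *m C = invmx B ->
  C *m Zreg A B s *m C = colproj (C *m A^T *m sketchmx s).
Proof.
move=> sC CC; rewrite /colproj (gram_factor A s sC CC) !trmx_mul trmxK sC.
by rewrite /Zreg -scalemxAr -scalemxAl !mulmxA.
Qed.

(** With [C = B^(-1/2)], [Zreg] is [C^-1 Pi C^-1] for a projection [Pi] whose entries are at most 1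
    in absolute value. Only [Pi] depends on the sketch, so the bound is uniform. *)
Lemma Zreg_bmf n (A B : 'M[R]_n) i j : posdefmx B -> bmf (fun s => Zreg A B s i j).
Proof.
move=> hB; split; first exact: measurable_Zreg.
have hC := posdef_inv hB; have [pC CC] := posdef_sqrtP hC.
set C := posdef_sqrt (invmx B) in pC CC.
have Cu := posdef_unit pC; have [sC _] := pC.
exists (\sum_k \sum_l `|invmx C i l| * `|invmx C k j|) => s.
have -> : Zreg A B s = invmx C *m colproj (C *m A^T *m sketchmx s) *m invmx C.
  by rewrite -(Zreg_colproj _ _ sC CC) mulmxA mulmxK// mulKmx.
rewrite mxE (le_trans (ler_norm_sum _ _ _))// ler_sum// => k _.
rewrite mxE mulr_suml (le_trans (ler_norm_sum _ _ _))// ler_sum// => l _.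
rewrite !normrM -mulrA ler_wpM2l// -[leRHS]mul1r ler_wpM2r//.
exact: colproj_entry.
Qed.
End Projection.

(** * Random matrices and sandwich recursions *)

Section RandomMatrices.
Context d (T : measurableType d) (R : realType).

Definition bmf_mx m n (F : T -> 'M[R]_(m, n)) :=
  forall i j, bmf (fun w => F w i j).

Definition measurable_mx m n (F : T -> 'M[R]_(m, n)) :=
  forall i j, measurable_fun setT (fun w => F w i j).

Lemma bmf_mx_cst m n (M : 'M[R]_(m, n)) : bmf_mx (fun=> M).
Proof. by move=> i j; exact: bmf_cst. Qed.

Lemma bmf_mxB m n (F G : T -> 'M[R]_(m, n)) :
  bmf_mx F -> bmf_mx G -> bmf_mx (fun w => F w - G w).
Proof. by move=> bF bG i j; under eq_fun do rewrite !mxE; exact: bmfB. Qed.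

Lemma bmf_mxM m n p (F : T -> 'M[R]_(m, n)) (G : T -> 'M[R]_(n, p)) :
  bmf_mx F -> bmf_mx G -> bmf_mx (fun w => F w *m G w).
Proof.
move=> bF bG i j; under eq_fun do rewrite !mxE.
by apply: bmf_sum => k; exact: bmfM.
Qed.

Lemma measurable_mxM m n p (F : T -> 'M[R]_(m, n)) (G : T -> 'M[R]_(n, p)) :
  measurable_mx F -> measurable_mx G -> measurable_mx (fun w => F w *m G w).
Proof.
move=> mF mG i j; under eq_fun do rewrite !mxE.
by apply: measurable_sum => k; exact: measurable_funM.
Qed.

Lemma measurable_mx_cst m n (M : 'M[R]_(m, n)) : measurable_mx (fun=> M).
Proof. by move=> i j; exact: measurable_cst. Qed.

Lemma measurable_mxB m n (F G : T -> 'M[R]_(m, n)) :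
  measurable_mx F -> measurable_mx G -> measurable_mx (fun w => F w - G w).
Proof. by move=> mF mG i j; under eq_fun do rewrite !mxE; exact: measurable_funB. Qed.

Context (P : probability T R).
Local Notation E f := (Rintegral P setT f).

Lemma expectation_mxE m n (F : T -> 'M[R]_(m, n)) i j :
  expectation_mx P F i j = E (fun w => F w i j).
Proof. by rewrite mxE unlock. Qed.

Lemma expectation_mx_cst m n (M : 'M[R]_(m, n)) : expectation_mx P (fun=> M) = M.
Proof. by apply/matrixP => i j; rewrite expectation_mxE mean_cst. Qed.

Lemma expectation_mxMl m n p (U : 'M[R]_(m, n)) (F : T -> 'M[R]_(n, p)) :
  bmf_mx F -> expectation_mx P (fun w => U *m F w) = U *m expectation_mx P F.
Proof.
move=> bF; apply/matrixP => i j; rewrite expectation_mxE mxE.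
under eq_Rintegral do rewrite mxE.
rewrite mean_sum => [|k]; last exact: bmfZ.
by apply: eq_bigr => k _; rewrite meanZ// expectation_mxE.
Qed.

Lemma expectation_mx_tr m n (F : T -> 'M[R]_(m, n)) :
  expectation_mx P (fun w => (F w)^T) = (expectation_mx P F)^T.
Proof.
apply/matrixP => i j; rewrite expectation_mxE mxE expectation_mxE.
by under eq_Rintegral do rewrite mxE.
Qed.

Lemma expectation_mxMr m n p (F : T -> 'M[R]_(m, n)) (U : 'M[R]_(n, p)) :
  bmf_mx F -> expectation_mx P (fun w => F w *m U) = expectation_mx P F *m U.
Proof.
move=> bF; apply: trmx_inj; rewrite -expectation_mx_tr trmx_mul -expectation_mx_tr.
rewrite -expectation_mxMl; last first.
  by move=> i j; under eq_fun do rewrite mxE; exact: bF.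
by congr expectation_mx; apply/funext => w; rewrite trmx_mul.
Qed.

Lemma expectation_mxB m n (F G : T -> 'M[R]_(m, n)) : bmf_mx F -> bmf_mx G ->
  expectation_mx P (fun w => F w - G w) = expectation_mx P F - expectation_mx P G.
Proof.
move=> bF bG; apply/matrixP => i j; rewrite [RHS]mxE [X in _ + X]mxE !expectation_mxE.
by under eq_Rintegral do rewrite !mxE; rewrite meanB.
Qed.

Lemma bmf_dot n (F : T -> 'M[R]_n) u v : bmf_mx F ->
  bmf (fun w => dot u (F w *m v)).
Proof.
move=> bF; rewrite /dot.
exact: (bmf_mxM (bmf_mx_cst u^T) (bmf_mxM bF (bmf_mx_cst v))).
Qed.

Lemma dot_expectation n (F : T -> 'M[R]_n) u v : bmf_mx F ->
  dot u (expectation_mx P F *m v) = E (fun w => dot u (F w *m v)).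
Proof.
move=> bF; rewrite /dot -expectation_mxMr// -expectation_mxMl ?expectation_mxE//.
exact: (bmf_mxM bF (bmf_mx_cst v)).
Qed.

Lemma mxtrace_expectation n (F : T -> 'M[R]_n) : bmf_mx F ->
  \tr (expectation_mx P F) = E (fun w => \tr (F w)).
Proof.
move=> bF; rewrite /mxtrace mean_sum//.
by apply: eq_bigr => i _; rewrite expectation_mxE.
Qed.

Lemma expectation_mx_ae m n (F G : T -> 'M[R]_(m, n)) :
    measurable_mx F -> bmf_mx G -> {ae P, forall w, F w = G w} ->
  integrable_mx P F /\ expectation_mx P F = expectation_mx P G.
Proof.
move=> mF bG FG.
have FGij i j : {ae P, forall w, F w i j = G w i j} by apply: filterS FG => w ->.
split=> [i j|]; first exact: (ae_integrable (mF i j) (bG i j)).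
by apply/matrixP => i j; rewrite !expectation_mxE; exact: mean_ae.
Qed.
End RandomMatrices.

(** * Expectation of a two-sided linear recursion driven by independent draws *)

Section SandwichRecursion.
Context d (T : measurableType d) (R : realType) (P : probability T R) (n : nat).
Context (S : {RV P >-> sketch R n}) (draw : nat -> {RV P >-> sketch R n}).
Hypothesis hdraw : iid_copies S draw.
Implicit Types (F G : sketch R n -> 'M[R]_n) (M : 'M[R]_n).
Local Notation E f := (Rintegral P setT f).

(** The common shape of both error recursions; the row variant has [G] constantly equal to the
    identity. *)
Definition sandwich F G (s : sketch R n) M := F s *m M *m G s.

Lemma sandwich_entry F G s M i j :
  sandwich F G s M i j = \sum_k \sum_l M l k * (F s i l * G s k j).
Proof.
rewrite mxE; apply: eq_bigr => k _; rewrite mxE mulr_suml.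
by apply: eq_bigr => l _; ring.
Qed.

Lemma past_sandwich F G M k : bmf_mx F -> bmf_mx G ->
  forall i j, past draw k (fun w => iterates (sandwich F G) draw M k w i j).
Proof.
move=> bF bG; elim: k => [|k IH] i j /=; first exact: past_cst.
under eq_fun do rewrite sandwich_entry.
apply: past_sum => a; apply: past_sum => b.
have [indX _] := hdraw.
exact: (past_mul indX (IH b a) (bmfM (bF i b) (bG a j))).
Qed.

(** Each entry is a finite sum of products of an entry of the current iterate and a function of the
    fresh draw. Independence factors the means, and equality in distribution replaces the draw by
    [S]. *)
Lemma expectation_sandwich F G M k : bmf_mx F -> bmf_mx G ->
  expectation_mx P (iterates (sandwich F G) draw M k.+1) =
  expectation_mx P (fun w => sandwich F G (S w)
    (expectation_mx P (iterates (sandwich F G) draw M k))).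
Proof.
move=> bF bG; apply/matrixP => i j; rewrite !expectation_mxE /=.
under eq_Rintegral do rewrite sandwich_entry.
under [RHS]eq_Rintegral do rewrite sandwich_entry.
have [indX distX] := hdraw.
have bFG a b : bmf (fun s => F s i b * G s a j) by exact: bmfM.
have pst := past_sandwich M k bF bG.
have bm (X : {RV P >-> sketch R n}) a b : bmf (fun w => F (X w) i b * G (X w) a j).
  exact: (bmf_comp (measurable_funPT X) (bFG a b)).
rewrite !mean_sum; [|by move=> a; apply: bmf_sum => b; first
  [by apply: bmfZ; exact: bm
  |by case: (past_mul indX (pst b a) (bFG a b))]..].
apply: eq_bigr => a _; rewrite !mean_sum; [|by move=> b; first
  [by apply: bmfZ; exact: bm
  |by case: (past_mul indX (pst b a) (bFG a b))]..].
apply: eq_bigr => b _; rewrite meanZ; last exact: bm.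
rewrite (past_mean indX (pst b a) (bFG a b)) expectation_mxE; congr (_ * _).
exact: (mean_eq_distribution (distX k) (bFG a b)).
Qed.

Lemma measurable_sandwich F G M k : measurable_mx F -> measurable_mx G ->
  measurable_mx (iterates (sandwich F G) draw M k).
Proof.
move=> mF mG; elim: k => [|k IH]; first exact: measurable_mx_cst.
have mX (H : sketch R n -> 'M[R]_n) : measurable_mx H -> measurable_mx (H \o draw k).
  by move=> mH i j; exact: (measurableT_comp (mH i j) (measurable_funPT (draw k))).
exact: (measurable_mxM (measurable_mxM (mX F mF) IH) (mX G mG)).
Qed.

Lemma ae_sandwich F G F' G' M k :
    (forall k, {ae P, forall w, F (draw k w) = F' (draw k w)}) ->
    (forall k, {ae P, forall w, G (draw k w) = G' (draw k w)}) ->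
  {ae P, forall w, iterates (sandwich F G) draw M k w =
                   iterates (sandwich F' G') draw M k w}.
Proof.
move=> FF' GG'; elim: k => [|k IH]; first exact: aeW.
by apply: filterS3 (FF' k) (GG' k) IH => w /= FE GE ->; rewrite /sandwich FE GE.
Qed.
End SandwichRecursion.

(** * Errors of the two algorithms *)

Section ErrorRecursions.
Variables (R : realType) (n : nat) (A B : 'M[R]_n).
Hypothesis hA : A \in unitmx.
Implicit Types (s : sketch R n) (X M z : 'M[R]_n).

Lemma alg1_step_error s X : alg1_step A B s X - invmx A =
  sandwich (fun s => 1%:M - invmx B *m Zmx A B s) (fun=> 1%:M) s (X - invmx A).
Proof.
rewrite /sandwich mulmx1 mulmxBl mul1mx /alg1_step addrAC; congr (_ + _).
have -> : 1%:M - A *m X = - (A *m (X - invmx A)).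
  by rewrite mulmxBr mulmxV// opprB.
by rewrite mulmxN /Zmx !mulmxA.
Qed.

Hypothesis sB : B^T = B.

Lemma Zmx_sym s : (Zmx A B s)^T = Zmx A B s.
Proof.
by rewrite /Zmx !trmx_mul !trmxK !trmx_inv !trmx_mul !trmxK trmx_inv sB !mulmxA.
Qed.

Hypothesis sA : A^T = A.

(** With [Y = X - A^-1], the two linear corrections are [Y Z B^-1] and its transpose. Symmetry of
    [Y] turns the latter into [B^-1 Z Y], and the quadratic correction is [B^-1 Z Y Z B^-1]. *)
Lemma alg3_step_error s X : X^T = X -> alg3_step A B s X - invmx A =
  sandwich (fun s => 1%:M - invmx B *m Zmx A B s)
           (fun s => 1%:M - Zmx A B s *m invmx B) s (X - invmx A).
Proof.
move=> sX; rewrite /alg3_step.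
set L := _ *m invmx _ *m _.
have ZE : Zmx A B s = A *m L *m A by rewrite /Zmx /L sA !mulmxA.
have sY : (X - invmx A)^T = X - invmx A by rewrite linearB /= trmx_inv sA sX.
have ME : X *m A - 1%:M = (X - invmx A) *m A by rewrite mulmxBl mulVmx.
have AXA : A *m X *m A - A = A *m (X - invmx A) *m A.
  by rewrite mulmxBr mulmxBl mulmxV// mul1mx.
have sZ := Zmx_sym s.
have sBi : (invmx B)^T = invmx B by rewrite trmx_inv sB.
have sL : L^T = L.
  by rewrite /L !trmx_mul !trmxK !trmx_inv !trmx_mul !trmxK sA sBi !mulmxA.
clearbody L; rewrite /sandwich; move: (Zmx A B s) ZE sZ => Z ZE sZ.
rewrite ME AXA {ME AXA}; set Y := X - invmx A in sY *.
have {}sX : X = Y + invmx A by rewrite subrK.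
clearbody Y; rewrite {}sX.
have -> : Y *m A *m (L *m A *m invmx B) = Y *m (Z *m invmx B).
  by rewrite ZE !mulmxA.
have -> : (L *m A *m invmx B)^T *m (A *m Y *m A) *m (L *m A *m invmx B) =
    invmx B *m Z *m Y *m (Z *m invmx B).
  by rewrite !trmx_mul sL sA sBi ZE !mulmxA.
rewrite !trmx_mul sBi sZ sY mulmxBl mul1mx mulmxBr mulmx1 mulmxBl !mulmxA.
(* Once the four monomials are abstracted, only an identity in an additive group remains. *)
move: (invmx A) (Y *m Z *m invmx B) (invmx B *m Z *m Y)
  (invmx B *m Z *m Y *m Z *m invmx B) => e a b c.
by rewrite !(addrAC _ e) subrK opprB addrA (addrAC Y (- a)) (addrAC _ (- a) c).
Qed.

Lemma alg3_error_sym s M : M^T = M ->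
  let F s := 1%:M - invmx B *m Zmx A B s in
  let G s := 1%:M - Zmx A B s *m invmx B in
  (sandwich F G s M)^T = sandwich F G s M.
Proof.
move=> sM /=; have sZ := Zmx_sym s; rewrite /sandwich.
move: (Zmx A B s) sZ => Z sZ.
rewrite !trmx_mul sM !linearB /= !trmx_mul trmx1 sZ trmx_inv sB.
by rewrite !mulmxA.
Qed.
End ErrorRecursions.

(** * Contraction of the expected error and bounds on the smallest eigenvalue *)

Section Contraction.
Context d (T : measurableType d) (R : realType) (P : probability T R) (n : nat).
Context (A B : 'M[R]_n) (S : {RV P >-> sketch R n}).
Hypotheses (n_gt0 : (0 < n)%N) (hB : posdefmx B).
Local Notation E f := (Rintegral P setT f).
Local Notation C := (posdef_sqrt (invmx B)).
Local Notation D := (posdef_sqrt B).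
Local Notation proj s := (colproj (C *m A^T *m sketchmx s)).

Definition EZreg := expectation_mx P (fun w => Zreg A B (S w)).
Local Notation lam := (lambda_min (C *m EZreg *m C)).

Let CC : C *m C = invmx B. Proof. by have [] := posdef_sqrtP (posdef_inv hB). Qed.
Let sC : C^T = C. Proof. by have [[]] := posdef_sqrtP (posdef_inv hB). Qed.
Let sD : D^T = D. Proof. by have [[]] := posdef_sqrtP hB. Qed.
Let Du : D \in unitmx. Proof. by have [/posdef_unit] := posdef_sqrtP hB. Qed.
Let CE : C = invmx D. Proof. exact: posdef_sqrt_inv. Qed.
Let CD : C *m D = 1%:M. Proof. by rewrite CE mulVmx. Qed.
Let DC : D *m C = 1%:M. Proof. by rewrite CE mulmxV. Qed.

Let DB : D *m invmx B = C. Proof. by rewrite -[RHS]mul1mx -DC -mulmxA CC. Qed.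
Let BD : invmx B *m D = C. Proof. by rewrite -[RHS]mulmx1 -CD mulmxA CC. Qed.

Lemma Zreg_bmf_mx : bmf_mx (Zreg A B).
Proof. by move=> i j; exact: Zreg_bmf. Qed.

Lemma Zreg_comp_bmf_mx (X : {RV P >-> sketch R n}) : bmf_mx (Zreg A B \o X).
Proof. by move=> i j; exact: (bmf_comp (measurable_funPT X) (Zreg_bmf_mx i j)). Qed.

Lemma proj_bmf_mx : bmf_mx (fun w => proj (S w)).
Proof.
have -> : (fun w => proj (S w)) = (fun w => C *m Zreg A B (S w) *m C).
  by apply/funext => w; rewrite Zreg_colproj.
exact: bmf_mxM (bmf_mxM (bmf_mx_cst _ C) (Zreg_comp_bmf_mx S)) (bmf_mx_cst _ C).
Qed.

Lemma expectation_proj : C *m EZreg *m C = expectation_mx P (fun w => proj (S w)).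
Proof.
have bZ := Zreg_comp_bmf_mx S.
rewrite /EZreg -expectation_mxMl// -expectation_mxMr; last first.
  exact: bmf_mxM (bmf_mx_cst _ C) bZ.
by congr expectation_mx; apply/funext => w; rewrite Zreg_colproj.
Qed.

Lemma expectation_proj_sym : (C *m EZreg *m C)^T = C *m EZreg *m C.
Proof.
rewrite expectation_proj -expectation_mx_tr.
by congr expectation_mx; apply/funext => w; rewrite colproj_sym.
Qed.

Lemma expectation_proj_ge0 v : 0 <= dot v (C *m EZreg *m C *m v).
Proof.
rewrite expectation_proj dot_expectation; last exact: proj_bmf_mx.
rewrite -[leLHS](mean_cst P); apply: mean_le => [||w]; first exact: bmf_cst.
  exact/bmf_dot/proj_bmf_mx.
by rewrite colproj_quad dot_ge0.
Qed.

Lemma projC_bmf_mx : bmf_mx (fun w => 1%:M - proj (S w)).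
Proof. exact: bmf_mxB (bmf_mx_cst _ _) proj_bmf_mx. Qed.

Lemma expectation_projC :
  1%:M - C *m EZreg *m C = expectation_mx P (fun w => 1%:M - proj (S w)).
Proof.
rewrite (expectation_mxB P (bmf_mx_cst T 1%:M) proj_bmf_mx).
by rewrite expectation_mx_cst expectation_proj.
Qed.

Lemma expectation_projC_ge0 v : 0 <= dot v ((1%:M - C *m EZreg *m C) *m v).
Proof.
rewrite expectation_projC dot_expectation; last exact: projC_bmf_mx.
rewrite -[leLHS](mean_cst P); apply: mean_le => [||w]; first exact: bmf_cst.
  exact/bmf_dot/projC_bmf_mx.
by rewrite colprojC_quad dot_ge0.
Qed.

Lemma expectation_projC_le v :
  dot v ((1%:M - C *m EZreg *m C) *m v) <= (1 - lam) * dot v v.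
Proof.
have [_ ray] := rayleigh n_gt0 expectation_proj_sym.
by rewrite mulmxBl mul1mx dotBr mulrBl mul1r lerD2l lerN2.
Qed.

Lemma lambda_min_ge0 : 0 <= lam.
Proof.
have [ev _] := rayleigh n_gt0 expectation_proj_sym.
exact: psd_eigenvalue expectation_proj_ge0 expectation_proj_sym ev.
Qed.

Lemma lambda_min_le1 : lam <= 1.
Proof.
(* At a unit vector, the form of [I - E Pi] lies between 0 and [1 - lam]. *)
rewrite -subr_ge0; have := expectation_projC_le (delta_mx (Ordinal n_gt0) 0).
by rewrite dot_delta1 mulr1; apply: le_trans; exact: expectation_projC_ge0.
Qed.

(** Sum the Rayleigh bound over the standard basis. *)
Lemma lambda_min_trace : lam * n%:R <= E (fun w => \tr (proj (S w))).
Proof.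
have [_ ray] := rayleigh n_gt0 expectation_proj_sym.
rewrite -(mxtrace_expectation P proj_bmf_mx) -expectation_proj /mxtrace.
rewrite mulr_natr -[X in _ *+ X]card_ord -sumr_const ler_sum// => i _.
by have := ray (delta_mx i 0); rewrite dot_delta1 mulr1 dot_delta.
Qed.

Lemma trace_proj_le : E (fun w => \tr (proj (S w))) <= n%:R.
Proof.
rewrite -[leRHS](mean_cst P); apply: mean_le => [||w].
- by apply: bmf_sum => i; exact: proj_bmf_mx.
- exact: bmf_cst.
- rewrite -[X in _ <= X%:R]card_ord -sumr_const ler_sum// => i _.
  exact: le_trans (ler_norm _) (colproj_entry _ _ _).
Qed.

(** Conjugation by [D = B^(1/2)] turns the left factor into [I - E Pi], a symmetric matrix whose
    form lies between 0 and [(1 - lam) |v|^2]. *)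
Lemma alg1_contraction W c : 0 <= c -> bilinear_bound (D *m W *m D) c ->
  bilinear_bound (D *m ((1%:M - invmx B *m EZreg) *m W) *m D) ((1 - lam) * c).
Proof.
move=> c0 Wc.
have -> : D *m ((1%:M - invmx B *m EZreg) *m W) *m D =
    (1%:M - C *m EZreg *m C) *m (D *m W *m D).
  rewrite mulmxBl mul1mx [RHS]mulmxBl mul1mx mulmxBr mulmxBl; congr (_ - _).
  by rewrite !mulmxA DB -(mulmxA _ C D) CD mulmx1.
apply: bilinear_bound_mul => //; first by rewrite subr_ge0 lambda_min_le1.
apply: bilinear_bound_psd; [|exact: expectation_projC_ge0|exact: expectation_projC_le].
by rewrite linearB /= trmx1 expectation_proj_sym.
Qed.

Lemma alg3_contraction W c : 0 <= c -> bilinear_bound (D *m W *m D) c ->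
  let F s := 1%:M - invmx B *m Zreg A B s in
  let G s := 1%:M - Zreg A B s *m invmx B in
  bilinear_bound (D *m expectation_mx P (fun w => sandwich F G (S w) W) *m D)
    ((1 - lam) * c).
Proof.
move=> c0 Wc F G u v.
have FE s : D *m F s = (1%:M - proj s) *m D.
  rewrite -(Zreg_colproj A s sC CC) mulmxBr mulmx1 mulmxBl mul1mx.
  by rewrite -(mulmxA _ C D) CD mulmx1 !mulmxA DB.
have GE s : G s *m D = D *m (1%:M - proj s).
  rewrite -(Zreg_colproj A s sC CC) mulmxBl mul1mx mulmxBr mulmx1.
  by rewrite !mulmxA DC mul1mx -!mulmxA BD.
have bF : bmf_mx (fun w => F (S w)).
  apply: bmf_mxB; first exact: bmf_mx_cst.
  exact: bmf_mxM (bmf_mx_cst _ _) (Zreg_comp_bmf_mx S).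
have bG : bmf_mx (fun w => G (S w)).
  apply: bmf_mxB; first exact: bmf_mx_cst.
  exact: bmf_mxM (Zreg_comp_bmf_mx S) (bmf_mx_cst _ _).
have bs : bmf_mx (fun w => sandwich F G (S w) W).
  exact: bmf_mxM (bmf_mxM bF (bmf_mx_cst _ W)) bG.
have bDs : bmf_mx (fun w => D *m sandwich F G (S w) W).
  exact: bmf_mxM (bmf_mx_cst _ D) bs.
have bDsD : bmf_mx (fun w => D *m sandwich F G (S w) W *m D).
  exact: bmf_mxM bDs (bmf_mx_cst _ D).
rewrite -expectation_mxMl// -expectation_mxMr// dot_expectation//.
rewrite -meanZ; last exact: bmf_dot.
have bK x : bmf (fun w => dot x ((1%:M - proj (S w)) *m x)).
  exact/bmf_dot/projC_bmf_mx.
(* Pointwise, the bound on [D W D] is applied to the projected vectors. Idempotence turns their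
   squared norms into forms linear in [Pi], so that only [E Pi] remains after averaging. *)
apply: (@le_trans _ _ (E (fun w => c * (dot u ((1%:M - proj (S w)) *m u) +
                                     dot v ((1%:M - proj (S w)) *m v))))).
  apply: mean_le => [||w]; [exact/bmfZ/bmf_dot|exact/bmfZ/bmfD|].
  have -> : D *m sandwich F G (S w) W *m D =
      (1%:M - proj (S w)) *m (D *m W *m D) *m (1%:M - proj (S w)).
    by rewrite /sandwich !mulmxA FE -!mulmxA GE !mulmxA.
  have sK : (1%:M - proj (S w))^T = 1%:M - proj (S w).
    by rewrite linearB /= trmx1 colproj_sym.
  rewrite !colprojC_quad; move: (1%:M - proj (S w)) sK => K sK.
  by rewrite -!mulmxA -{1}sK -dotMl !mulmxA -[X in dot _ X]mulmxA; exact: Wc.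
rewrite meanZ; last exact: bmfD.
rewrite meanD// -!(dot_expectation P _ _ projC_bmf_mx) -expectation_projC.
rewrite (mulrC (1 - lam)) -mulrA ler_wpM2l// mulrDr lerD//; exact: expectation_projC_le.
Qed.
End Contraction.

(** * Almost sure invertibility of the Gram matrix *)

Section Regularity.
Context d (T : measurableType d) (R : realType) (P : probability T R) (n : nat).
Context (A B : 'M[R]_n) (S : {RV P >-> sketch R n}).
Hypotheses (hA : A \in unitmx) (hB : posdefmx B).

(** The Gram matrix is [G^T G] for [G = C A^T S], and the invertible factor [C A^T] preserves the
    rank of [S]. *)
Lemma gram_det_full_rank (s : sketch R n) :
  \rank (sketchmx s) = ncols s -> \det (gram A B s) != 0.
Proof.
move=> rs; have [pC CC] := posdef_sqrtP (posdef_inv hB).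
move: (posdef_sqrt (invmx B)) pC CC => C pC CC.
have [sC _] := pC.
rewrite -(gram_factor A s sC CC); apply: gram_det_neq0; rewrite -[RHS]rs eqmxMfull//.
by rewrite row_full_unit unitmx_mul unitmx_tr hA posdef_unit.
Qed.

Hypothesis hS : {ae P, forall w, \rank (sketchmx (S w)) = ncols (S w)}.

(** Full rank is assumed for [S], whereas the algorithms use its copies. The set where the Gram
    determinant vanishes is measurable, so its null probability transfers by equality in
    distribution. *)
Lemma gram_det_ae (X : {RV P >-> sketch R n}) :
    (forall U, measurable U -> distribution P X U = distribution P S U) ->
  {ae P, forall w, \det (gram A B (X w)) != 0}.
Proof.
move=> XS; pose N := [set s : sketch R n | \det (gram A B s) = 0].
have mN : measurable N.
  rewrite -[N]setTI.
  exact: (measurable_gram_det A B measurableT (measurable_set1 0)).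
have mX (Y : {RV P >-> sketch R n}) : measurable (Y @^-1` N).
  by rewrite -[X in measurable X]setTI; exact: measurable_funPT.
have PS : P (S @^-1` N) = 0.
  apply/(negligibleP _ (mX S)); apply: negligibleS hS => w /= detN rw.
  by have := gram_det_full_rank rw; rewrite detN eqxx.
have : P.-negligible (X @^-1` N).
  by apply/(negligibleP _ (mX X)); rewrite -PS; exact: (XS N mN).
by apply: negligibleS => w /= /negP; rewrite negbK => /eqP.
Qed.

Lemma Zmx_ae (X : {RV P >-> sketch R n}) :
    (forall U, measurable U -> distribution P X U = distribution P S U) ->
  {ae P, forall w, Zmx A B (X w) = Zreg A B (X w)}.
Proof. by move=> /gram_det_ae; apply: filterS => w; exact: Zmx_regular. Qed.

Lemma measurable_mx_Zmx : measurable_mx (Zmx A B).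
Proof. by move=> i j; exact: measurable_Zmx. Qed.
End Regularity.

Theorem theorem35 (R : realType) (d : measure_display) (T : measurableType d)
    (P : probability T R) (n : nat) (A B X0 : 'M[R]_n)
    (S : {RV P >-> sketch R n}) (draw : nat -> {RV P >-> sketch R n})
    (hn : (0 < n)%N)
    (hA : A \in unitmx)
    (hB : posdefmx B)
    (hS : {ae P, forall w, \rank (sketchmx (S w)) = ncols (S w)})
    (hdraw : iid_copies S draw) :
  let Z := fun w => Zmx A B (S w) in
  let q := fun w => (ncols (S w))%:R : R in
  let X1 := iterates (alg1_step A B) draw X0 in
  let X3 := iterates (alg3_step A B) draw X0 in
  let EZ := expectation_mx P Z in
  let Eq := fine ('E_P[q])%E in
  let rho := 1 - lambda_min (posdef_sqrt (invmx B) *m EZ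
                             *m posdef_sqrt (invmx B)) in
  (* well-definedness of the expectations below *)
  [/\ integrable_mx P Z,
      P.-integrable setT (EFin \o q),
      (forall k, integrable_mx P (X1 k)) &
      (A^T = A -> X0^T = X0 -> forall k, integrable_mx P (X3 k))] /\
  [/\ (forall k, expectation_mx P (fun w => X1 k.+1 w - invmx A)
         = (1%:M - invmx B *m EZ)
             *m expectation_mx P (fun w => X1 k w - invmx A)),
      (forall k, dual_Bnorm B (expectation_mx P (fun w => X1 k w - invmx A))
         <= rho ^+ k * dual_Bnorm B (X0 - invmx A)),
      (A^T = A -> X0^T = X0 ->
       forall k, dual_Bnorm B (expectation_mx P (fun w => X3 k w - invmx A))
         <= rho ^+ k * dual_Bnorm B (X0 - invmx A)) &
      [/\ 0 <= 1 - Eq / n%:R, 1 - Eq / n%:R <= rho & rho <= 1]].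
Proof.
move=> Z q X1 X3 EZ Eq rho.
have bZ : bmf_mx (Zreg A B) := Zreg_bmf_mx A hB.
have mZ : measurable_mx (Zmx A B) := measurable_mx_Zmx A B.
have bcst (M : 'M[R]_n) : bmf_mx (fun _ : sketch R n => M) by exact: bmf_mx_cst.
have mcst (M : 'M[R]_n) : measurable_mx (fun _ : sketch R n => M).
  exact: measurable_mx_cst.
have [intZ EZE] : integrable_mx P Z /\ EZ = EZreg A B S.
  apply: expectation_mx_ae.
  - by move=> i j; exact: (measurableT_comp (mZ i j) (measurable_funPT S)).
  - exact: Zreg_comp_bmf_mx.
  - exact: (Zmx_ae hA hB hS).
have [_ distX] := hdraw.
have aeZ k := Zmx_ae hA hB hS (distX k).
pose F s := 1%:M - invmx B *m Zmx A B s; pose F' s := 1%:M - invmx B *m Zreg A B s.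
pose G s := 1%:M - Zmx A B s *m invmx B; pose G' s := 1%:M - Zreg A B s *m invmx B.
pose I1 (s : sketch R n) : 'M[R]_n := 1%:M.
have bI : bmf_mx I1 by exact: bcst.
have bF : bmf_mx F' by apply: bmf_mxB => //; exact: bmf_mxM.
have bG : bmf_mx G' by apply: bmf_mxB => //; exact: bmf_mxM.
have mF : measurable_mx F by apply: measurable_mxB => //; exact: measurable_mxM.
have mG : measurable_mx G by apply: measurable_mxB => //; exact: measurable_mxM.
have aeF k : {ae P, forall w, F (draw k w) = F' (draw k w)}.
  by apply: filterS (aeZ k) => w; rewrite /F /F' => ->.
have aeG k : {ae P, forall w, G (draw k w) = G' (draw k w)}.
  by apply: filterS (aeZ k) => w; rewrite /G /G' => ->.
have aeI k : {ae P, forall w, I1 (draw k w) = I1 (draw k w)} by exact: aeW.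
pose Y0 := X0 - invmx A.
have X1E k w : X1 k w - invmx A = iterates (sandwich F I1) draw Y0 k w.
  by elim: k => [//|k IH]; rewrite /= alg1_step_error// -/(X1 k w) IH.
(* The true error iterates agree almost surely with bounded ones, from which they inherit
   integrability and expectation. *)
have Y1 k : integrable_mx P (iterates (sandwich F I1) draw Y0 k) /\
    expectation_mx P (iterates (sandwich F I1) draw Y0 k) =
    expectation_mx P (iterates (sandwich F' I1) draw Y0 k).
  apply: expectation_mx_ae; first exact: measurable_sandwich.
    by move=> i j; have [] := past_sandwich hdraw Y0 k bF (bcst 1%:M) i j.
  exact: ae_sandwich.
have X3E : A^T = A -> X0^T = X0 -> forall k w,
    X3 k w - invmx A = iterates (sandwich F G) draw Y0 k w.
  move=> sA sX0 k w; have [sB _] := hB.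
  (* The error formula holds only at symmetric iterates, so symmetry is carried along in the same
     induction. *)
  have sX3 : forall j, (X3 j w)^T = X3 j w /\
      X3 j w - invmx A = iterates (sandwich F G) draw Y0 j w.
    elim=> [//|j [sX IH]]; have E := alg3_step_error hA sB sA (draw j w) sX.
    split; last by rewrite /= E -/(X3 j w) IH.
    rewrite -[X3 j.+1 w](subrK (invmx A)) linearD /= trmx_inv sA; congr (_ + _).
    by rewrite E alg3_error_sym// linearB /= sX trmx_inv sA.
  by have [] := sX3 k.
have Y3 k : integrable_mx P (iterates (sandwich F G) draw Y0 k) /\
    expectation_mx P (iterates (sandwich F G) draw Y0 k) =
    expectation_mx P (iterates (sandwich F' G') draw Y0 k).
  apply: expectation_mx_ae; first exact: measurable_sandwich.
    by move=> i j; have [] := past_sandwich hdraw Y0 k bF bG i j.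
  exact: ae_sandwich.
have shift (X : T -> 'M[R]_n) Y : (forall w, X w - invmx A = Y w) ->
    integrable_mx P Y -> integrable_mx P X.
  move=> XY iY i j; have -> : (fun w => (X w i j)%:E) =
      (fun w => (Y w i j)%:E) \+ (fun=> (invmx A i j)%:E).
    by apply/funext => w; rewrite /= -EFinD -XY !mxE subrK.
  by apply: integrableD => //; exact: (bmf_integrable P (bmf_cst T (invmx A i j))).
have rhoE : rho = 1 - lambda_min (posdef_sqrt (invmx B) *m EZreg A B S
                                  *m posdef_sqrt (invmx B)).
  by rewrite /rho EZE.
have rho_ge0 : 0 <= rho by rewrite rhoE subr_ge0 lambda_min_le1.
pose c0 := dual_Bnorm B Y0.
have c0_ge0 : 0 <= c0 by exact: spectral_norm_ge0.
have base : bilinear_bound (posdef_sqrt B *m Y0 *m posdef_sqrt B) c0.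
  exact: spectral_norm_bilinear.
have cst0 : expectation_mx P (fun _ : T => Y0) = Y0 by exact: expectation_mx_cst.
have step1 k : expectation_mx P (iterates (sandwich F' I1) draw Y0 k.+1) =
    (1%:M - invmx B *m EZreg A B S) *m
    expectation_mx P (iterates (sandwich F' I1) draw Y0 k).
  rewrite (expectation_sandwich hdraw Y0 k bF bI).
  move: (expectation_mx P (iterates (sandwich F' I1) _ _ _)) => W.
  rewrite /sandwich /I1.
  have bZS := Zreg_comp_bmf_mx A hB S.
  have bcT (M : 'M[R]_n) : bmf_mx (fun _ : T => M) by exact: bmf_mx_cst.
  have bBZ : bmf_mx (fun w => invmx B *m Zreg A B (S w)) by exact: bmf_mxM (bcT _) bZS.
  have bFS : bmf_mx (fun w => F' (S w)) by exact: bmf_mxB (bcT _) bBZ.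
  have -> : 1%:M - invmx B *m EZreg A B S = expectation_mx P (fun w => F' (S w)).
    rewrite (expectation_mxB P (bcT 1%:M) bBZ) expectation_mx_cst.
    by rewrite (expectation_mxMl P _ bZS).
  by rewrite -expectation_mxMr//; under eq_fun do rewrite mulmx1.
(* The number of columns is almost surely the trace of a projection; this gives both the
   integrability of [q] and the value of its mean. *)
have Sq : {ae P, forall w, q w = \tr (colproj (posdef_sqrt (invmx B) *m A^T
                                               *m sketchmx (S w)))}.
  apply: filterS hS => w /= rw; rewrite colproj_trace//.
  have [[sC _] CC] := posdef_sqrtP (posdef_inv hB).
  by rewrite (gram_factor A (S w) sC CC) gram_det_full_rank.
have mq : measurable_fun setT q.
  by have := measurableT_comp (@measurable_ncols R n) (measurable_funPT S).
have btr : bmf (fun w =>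
    \tr (colproj (posdef_sqrt (invmx B) *m A^T *m sketchmx (S w)))).
  by apply: bmf_sum => i; exact: proj_bmf_mx.
have EqE : Eq = Rintegral P setT
    (fun w => \tr (colproj (posdef_sqrt (invmx B) *m A^T *m sketchmx (S w)))).
  by rewrite -(mean_ae mq btr Sq) /Eq unlock.
have n0 : (0 : R) < n%:R by rewrite ltr0n.
split; split.
- exact: intZ.
- exact: ae_integrable Sq.
- by move=> k; apply: (shift _ _ (X1E k)); case: (Y1 k).
- by move=> sA sX0 k; apply: (shift _ _ (X3E sA sX0 k)); case: (Y3 k).
- move=> k; under eq_fun do rewrite X1E; under [in RHS]eq_fun do rewrite X1E.
  by rewrite (Y1 k.+1).2 (Y1 k).2 step1 EZE.
- move=> k; under eq_fun do rewrite X1E; rewrite (Y1 k).2.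
  (* The induction runs on the bilinear inequality, to which the one-step contraction applies. *)
  apply: spectral_norm_le => //; first by rewrite mulr_ge0 ?exprn_ge0.
  elim: k => [|k IH]; first by rewrite expr0 mul1r cst0.
  rewrite step1 exprS -mulrA {1}rhoE; apply: alg1_contraction => //.
  by rewrite mulr_ge0 ?exprn_ge0.
- move=> sA sX0 k; under eq_fun do rewrite X3E//; rewrite (Y3 k).2.
  apply: spectral_norm_le => //; first by rewrite mulr_ge0 ?exprn_ge0.
  elim: k => [|k IH]; first by rewrite expr0 mul1r cst0.
  rewrite (expectation_sandwich hdraw Y0 k bF bG) exprS -mulrA {1}rhoE.
  by apply: alg3_contraction => //; rewrite mulr_ge0 ?exprn_ge0.
- split.
  + by rewrite subr_ge0 ler_pdivrMr// mul1r EqE trace_proj_le.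
  + rewrite rhoE lerD2l lerN2 ler_pdivlMr// EqE; exact: lambda_min_trace.
  + by rewrite rhoE gerBl lambda_min_ge0.
Qed.
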